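(* Let $s\in\mathbb{C}$. If the integral converges, then \[ \psi(s)=\int_0^1\!\!\int_0^1\frac{(xy)^{s-1}-y}{(1-xy)\log(xy)}\,dx\,dy, \] where $\psi=\Gamma'/\Gamma$ is the digamma function. *)

(* Defs.v *)
From HB Require Import structures.
From mathcomp Require Import all_boot all_order all_algebra.
From mathcomp Require Import all_classical all_reals all_analysis.
From mathcomp.real_closed Require Import complex.
Set Implicit Arguments. Unset Strict Implicit. Unset Printing Implicit Defensive.
Import Order.TTheory GRing.Theory Num.Theory.
Import numFieldNormedType.Exports.
Local Open Scope classical_set_scope.
Local Open Scope ring_scope.

(* equip the complex numbers R[i] with their canonical normed-field topology *)
HB.instance Definition _ (R : rcfType) := NormedModule.copy R[i] (R[i])^o.

Section Defs.
Variable R : realType.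

(* a ^ z = exp (z ln a) for a real a > 0 and z complex *)
Definition cpow (a : R) (z : R[i]) : R[i] :=
  let t : R := complex.Im z * ln a in
  Complex (expR (complex.Re z * ln a) * cos t) (expR (complex.Re z * ln a) * sin t).

(* Gauss's limit formula: Gamma z = lim_{n->oo} n! n^z / (z (z+1) ... (z+n)) *)
Definition Gamma (z : R[i]) : R[i] :=
  lim ((fun n : nat => (n`!)%:R * cpow n%:R z / \prod_(k < n.+1) (z + k%:R))
        @ \oo).

Definition digamma (z : R[i]) : R[i] := (derive1 Gamma z) / Gamma z.

Definition integrand (s : R[i]) (p : R * R) : R[i] :=
  let x := p.1 in let y := p.2 in
  (cpow (x * y) (s - 1) - Complex y 0) / Complex ((1 - x * y) * ln (x * y)) 0.
End Defs.

Section Integral.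
Variable R : realType.
Definition unit_square : set (R * R) := `[0%R, 1%R] `*` `[0%R, 1%R].
Definition leb2 := (@lebesgue_measure R \x @lebesgue_measure R)%E.
End Integral.

(* Main.v *)
Require Import Defs.
From HB Require Import structures.
From mathcomp Require Import all_boot all_order all_algebra.
From mathcomp Require Import all_classical all_reals all_analysis.
From mathcomp Require Import measurable_realfun.
From mathcomp.real_closed Require Import complex.
From mathcomp Require Import ring lra.
Import Order.TTheory GRing.Theory Num.Theory.
Import numFieldNormedType.Exports.
Local Open Scope classical_set_scope.
Local Open Scope ring_scope.

(** For [Re w > 0] and [Re (w + h) > 0], Gauss's limit gives [Gamma (w + h) = Gamma w * P w h],
    where [P w h] is the convergent product of the factors
    [((k + 2) / (k + 1)) ^ h * (w + k) / (w + k + h) = 1 + h * b_k + O (h ^ 2 / (k + 1) ^ 2)] with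
    [b_k = ln ((k + 2) / (k + 1)) - 1 / (w + k)].  Hence [Gamma] does not vanish there and
    [digamma w] is the sum of the [b_k].

    On the other side, let [t = x y].  Multiplying the integrand by [t ^ n] gives integrals that
    tend to 0, and the difference of two consecutive ones is the integral of
    [(t ^ (s + n - 1) - y t ^ n) / ln t].  Writing [1 / (- ln t)] as the integral of [t ^ u] over
    [u >= 0], Tonelli's theorem evaluates it to [ln ((n + 2) / (n + 1)) - 1 / (s + n)], which is
    [b_n], and the sum telescopes.  Finally [Re s <= 0] is excluded, since then the modulus of the
    integrand is at least [t ^ (e - 1) / (- ln t)], whose integral is [1 / e], for every [e > 0]. *)

Import Normc.

(** * The real-valued modulus on [R[i]] and convergence in terms of it *)

Section ComplexNorm.
Context {R : realType}.
Implicit Types (z w : R[i]) (r : R).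

Lemma normc_ge0 z : 0 <= normc z.
Proof. by case: z => a b /=; exact: sqrtr_ge0. Qed.

Lemma normc_real r : normc (Complex r 0) = `|r|.
Proof. by rewrite /= expr0n /= addr0 sqrtr_sqr. Qed.

Lemma normcB z w : normc (z - w) = normc (w - z).
Proof. by rewrite -normcN opprB. Qed.

Lemma le_normcB z w : normc (z - w) <= normc z + normc w.
Proof. by rewrite (le_trans (le_normcD _ _))// normcN. Qed.

Lemma Re_le_normc z : `|complex.Re z| <= normc z.
Proof.
case: z => a b /=; rewrite -sqrtr_sqr ler_sqrt ?lerDl ?sqr_ge0//.
by rewrite addr_ge0 ?sqr_ge0.
Qed.

Lemma Im_le_normc z : `|complex.Im z| <= normc z.
Proof.
case: z => a b /=; rewrite -sqrtr_sqr ler_sqrt ?lerDr ?sqr_ge0//.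
by rewrite addr_ge0 ?sqr_ge0.
Qed.

Lemma normc_le_ReIm z : normc z <= `|complex.Re z| + `|complex.Im z|.
Proof.
case: z => a b /=.
have h : 0 <= `|a| + `|b| by rewrite addr_ge0.
rewrite -[leRHS]ger0_norm// -sqrtr_sqr ler_sqrt ?sqr_ge0//.
rewrite sqrrD !real_normK ?num_real// addrAC lerDl mulrn_wge0//; exact: mulr_ge0.
Qed.

Lemma ReD z w : complex.Re (z + w) = complex.Re z + complex.Re w.
Proof. by case: z; case: w. Qed.

Lemma ImD z w : complex.Im (z + w) = complex.Im z + complex.Im w.
Proof. by case: z; case: w. Qed.

Lemma ReN z : complex.Re (- z) = - complex.Re z.
Proof. by case: z. Qed.

Lemma Re_nat n : complex.Re (n%:R : R[i]) = n%:R.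
Proof. by rewrite -(rmorph_nat (real_complex R)). Qed.

(** The radii in the topology of [R[i]] are themselves elements of [R[i]]; positivity forces their
    imaginary part to be 0, so limits can be handled with real radii and the real squeeze
    theorem. *)
Lemma cvgc_normP {T} (F : set_system T) {FF : Filter F} (f : T -> R[i]) l :
  (f @ F --> l) <-> (normc (f x - l) @[x --> F] --> (0 : R)).
Proof.
split=> [|h].
- move=> /cvgrPdist_lt h; apply/cvgrPdist_lt => e e0.
  have e0' : 0 < (Complex e 0 : R[i]) by rewrite ltcE /= eqxx.
  near=> x; rewrite sub0r normrN ger0_norm ?normc_ge0//.
  have : `|l - f x| < Complex e 0 by near: x; exact: h.
  by rewrite ltcE /= normcB => /andP[].
- apply/cvgrPdist_lt => -[e e'] e0.
  have [-> {}e0] : e' = 0 /\ 0 < e by move: e0; rewrite ltcE /= => /andP[/eqP -> ->].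
  move/cvgrPdist_lt : h => /(_ _ e0) h; near=> x.
  rewrite ltcE /= eqxx /= normcB.
  have : `|0 - normc (f x - l)| < e by near: x; exact: h.
  by rewrite sub0r normrN ger0_norm ?normc_ge0.
Unshelve. all: by end_near. Qed.

Lemma cvgc_ReIm {T} (F : set_system T) {FF : Filter F} (f : T -> R[i]) a b :
  complex.Re (f x) @[x --> F] --> a -> complex.Im (f x) @[x --> F] --> b ->
  f @ F --> Complex a b.
Proof.
move=> ha hb; apply/cvgc_normP.
apply: (@squeeze_cvgr _ _ _ _ (cst 0) (fun x =>
  `|complex.Re (f x) - a| + `|complex.Im (f x) - b|)).
- near=> x; rewrite normc_ge0/= (le_trans (normc_le_ReIm _))//.
  by case: (f x).
- exact: cvg_cst.
- rewrite -[X in _ --> X]addr0; apply: cvgD.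
    rewrite -(normr0 R) -(subrr a); apply: cvg_norm; apply: cvgB => //; exact: cvg_cst.
  rewrite -(normr0 R) -(subrr b); apply: cvg_norm; apply: cvgB => //; exact: cvg_cst.
Unshelve. all: by end_near. Qed.

Lemma cvg_normc {T} (F : set_system T) {FF : Filter F} (f : T -> R[i]) l :
  f @ F --> l -> normc (f x) @[x --> F] --> normc l.
Proof.
move/cvgc_normP => /cvgrPdist_lt h; apply/cvgrPdist_lt => e e0.
near=> x; have hx : `|0 - normc (f x - l)| < e by near: x; exact: h.
rewrite sub0r normrN ger0_norm ?normc_ge0// in hx.
rewrite (le_lt_trans _ hx)//.
have h1 : normc (f x) <= normc (f x - l) + normc l.
  by rewrite -{1}(subrK l (f x)) le_normcD.
have h2 : normc l <= normc (f x - l) + normc (f x).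
  by rewrite normcB -{1}(subrK (f x) l) le_normcD.
rewrite ler_norml; apply/andP; split; lra.
Unshelve. all: by end_near. Qed.

End ComplexNorm.

(** * Products of factors close to 1 *)

Section InfiniteProduct.
Context {R : realType}.
Variables (a : nat -> R[i]) (e : nat -> R).
Hypothesis ae : forall k, normc (a k) <= e k.

Let S n := \sum_(k < n) e k.
Let P n := \prod_(k < n) (1 + a k).

Let e_ge0 k : 0 <= e k. Proof. exact: le_trans (normc_ge0 _) (ae k). Qed.

Let S_ge0 n : 0 <= S n. Proof. exact: sumr_ge0. Qed.

Let expS n : expR (S n) * (1 + e n) <= expR (S n.+1).
Proof. by rewrite /S big_ord_recr/= expRD ler_pM2l ?expR_gt0// expR_ge1Dx. Qed.

(** Induction on [P n.+1 - 1 = (P n - 1) * (1 + a n) + a n], with [1 + e n <= expR (e n)] to absorb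
    one more factor. *)
Lemma normc_prod1D_sub1 n : normc (P n - 1) <= expR (S n) - 1.
Proof.
elim: n => [|n IH]; first by rewrite /P /S !big_ord0 subrr normc0 expR0 subrr.
have -> : P n.+1 - 1 = (P n - 1) * (1 + a n) + a n.
  by rewrite /P big_ord_recr/=; ring.
rewrite (le_trans (le_normcD _ _))// normcM.
have h1 : normc (1 + a n) <= 1 + e n.
  by rewrite (le_trans (le_normcD _ _))// normc1 lerD2l.
have := expS n; have := ae n; have := normc_ge0 (P n - 1); have := normc_ge0 (1 + a n).
set x := normc _; set y := normc _; set z := normc _ => *.
have : y * x <= (expR (S n) - 1) * (1 + e n) by rewrite ler_pM.
nra.
Qed.

Lemma normc_prod1D n : normc (P n) <= expR (S n).
Proof.
have := normc_prod1D_sub1 n; rewrite -{2}(subrK 1 (P n)).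
have := le_normcD (P n - 1) 1; rewrite normc1; lra.
Qed.

(** The bound is of second order in [S n], which later isolates the derivative. The increment of the
    left side is [(P n - 1) * a n], controlled by the first-order bound. *)
Lemma normc_prod1D_sub2 n :
  normc (P n - 1 - \sum_(k < n) a k) <= expR (S n) - 1 - S n.
Proof.
elim: n => [|n IH].
  by rewrite /P /S !big_ord0 !subr0 subrr normc0 expR0 subrr.
have -> : P n.+1 - 1 - \sum_(k < n.+1) a k =
    (P n - 1 - \sum_(k < n) a k) + (P n - 1) * a n.
  by rewrite /P !big_ord_recr/=; ring.
rewrite (le_trans (le_normcD _ _))// normcM.
have -> : S n.+1 = S n + e n by rewrite /S big_ord_recr.
have := expS n; rewrite /S big_ord_recr/= -/(S n).
have := normc_prod1D_sub1 n; have := ae n; have := normc_ge0 (P n - 1).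
have := normc_ge0 (a n); move: IH.
set x := normc _; set y := normc _; set z := normc _ => *.
have : z * y <= (expR (S n) - 1) * e n by rewrite ler_pM.
nra.
Qed.

(** The increments [P k * a k] have modulus at most [expR E * e k], so the real and imaginary parts
    of [P] are, up to a constant, partial sums of absolutely convergent real series. *)
Lemma is_cvg_prod1D (E : R) : (forall n, S n <= E) -> cvgn P.
Proof.
move=> SE.
have Se : cvgn (series e).
  apply: nondecreasing_is_cvgn.
    by apply/nondecreasing_seqP => n; rewrite /series/= big_nat_recr//= lerDl.
  by exists E => _ [n _ <-]; rewrite /series/= big_mkord; exact: SE.
have PE (f : R[i] -> R) : (forall z, `|f z| <= normc z) ->
    (forall z w, f (z + w) = f z + f w) -> cvgn (fun n => f (P n)).
  move=> fn fD.
  have -> : (fun n => f (P n)) =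
      (cst (f 1) : nat -> R) + series (fun k => f (P k * a k)).
    apply/funext => n; rewrite fctE /=.
    elim: n => [|n IH]; first by rewrite /series /= big_geq// addr0 /P big_ord0.
    rewrite /series/= big_nat_recr//= addrA -[X in _ = X + _]IH.
    by rewrite /P big_ord_recr/= mulrDr mulr1 fD.
  apply: is_cvgD; first exact: is_cvg_cst.
  apply: normed_cvg.
  apply: (@series_le_cvg _ _ (fun k => expR E * e k)) => [k|k|k|] //=.
  - by rewrite mulr_ge0 ?expR_ge0.
  - rewrite (le_trans (fn _))// normcM ler_pM ?normc_ge0//.
    by rewrite (le_trans (normc_prod1D _))// ler_expR.
  - exact: is_cvg_seriesZ.
have hr := PE _ (@Re_le_normc R) (@ReD R).
have hi := PE _ (@Im_le_normc R) (@ImD R).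
apply/cvg_ex; exists (Complex (limn (fun n => complex.Re (P n)))
  (limn (fun n => complex.Im (P n)))).
exact: cvgc_ReIm.
Qed.

End InfiniteProduct.

(** The induction carries the sharper bound [2 - n%:R^-1]. At [n = 0] the convention [0^-1 = 0]
    makes it 2, so the step from 0 to 1 is treated apart. *)
Lemma sum_inv_square_le2 {R : realType} n :
  \sum_(k < n) (k.+1%:R ^-2 : R) <= 2.
Proof.
suff : \sum_(k < n) (k.+1%:R ^-2 : R) <= 2 - n%:R^-1.
  by move/le_trans; apply; rewrite gerBl invr_ge0.
elim: n => [|n IH]; first by rewrite big_ord0 invr0 subr0.
rewrite big_ord_recr/=.
case: n IH => [|n] IH; first by rewrite big_ord0; lra.
apply: (le_trans (lerD IH (lexx _))).
have h : 0 < n.+1%:R :> R by [].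
rewrite -[n.+2%:R]natr1; set x : R := n.+1%:R in h *.
rewrite -subr_ge0.
have -> : 2 - (x + 1)^-1 - (2 - x^-1 + (x + 1) ^- 2) = (x * (x + 1) ^+ 2)^-1.
  by field; rewrite !gt_eqF// ltr_wpDl.
by rewrite invr_ge0 mulr_ge0 ?ltW// exprn_gt0// addr_gt0.
Qed.

(** * First-order expansion of [cpow a h] with explicit remainder *)

Section ComplexPower.
Context {R : realType}.
Implicit Types (a t x : R) (z w h : R[i]).

Lemma mvt0 (f df : R -> R) t : (forall x, is_derive x 1 f (df x)) ->
  exists2 c, `|c| <= `|t| & f t - f 0 = df c * t.
Proof.
move=> fd.
have cf (A : set R) : {within A, continuous f}.
  apply: continuous_subspaceT => x; apply: differentiable_continuous.
  by apply/derivable1_diffP; have [] := fd x.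
have [t0|t0] := leP 0 t.
  have [c] := @MVT_segment R f df 0 t t0 (fun x _ => fd x) (cf _).
  rewrite in_itv/= => /andP[c0 ct] E; exists c; last by rewrite E subr0.
  by rewrite !ger0_norm.
have [c] := @MVT_segment R f df t 0 (ltW t0) (fun x _ => fd x) (cf _).
rewrite in_itv/= => /andP[c0 ct] E; exists c.
  by rewrite !ler0_norm ?lerN2// ltW.
by rewrite -opprB E sub0r mulrN opprK.
Qed.

Lemma norm_sin_le t : `|sin t| <= `|t|.
Proof.
have [c _] := @mvt0 sin cos t (fun x => is_derive_sin x).
by rewrite sin0 subr0 => ->; rewrite normrM ler_piMl// cos_max.
Qed.

(** The derivative of [cos] is bounded by the sine estimate at a point [c] with [|c| <= |t|]; the
    bound on [sin t - t] repeats this once more. The Taylor constants are lost, which only enlarges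
    later constants. *)
Lemma norm_cosB1_le t : `|cos t - 1| <= t ^+ 2.
Proof.
have [c ct] := @mvt0 cos (fun x => - sin x) t (fun x => is_derive_cos x).
rewrite cos0 => ->; rewrite normrM normrN -real_normK ?num_real// expr2.
by rewrite ler_wpM2r// (le_trans (norm_sin_le _)).
Qed.

Lemma norm_sinBid_le t : `|sin t - t| <= `|t| ^+ 3.
Proof.
have [c ct] := @mvt0 (fun x => sin x - x) (fun x => cos x - 1) t _.
rewrite sin0 !subr0 => ->; rewrite normrM exprSr ler_wpM2r//.
rewrite (le_trans (norm_cosB1_le _))// -real_normK ?num_real//.
by rewrite lerXn2r ?nnegrE.
Qed.

Lemma norm_expRB1_le x : `|expR x - 1| <= `|x| * expR `|x|.
Proof.
have h1 := expR_ge1Dx x; have h2 := expR_ge1Dx (- x).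
have h3 : expR x * expR (- x) = 1 by rewrite -expRD subrr expR0.
have e0 := expR_gt0 x; have xe : expR x <= expR `|x| by rewrite ler_expR ler_norm.
have xx := normr_ge0 x; have x1 : 1 <= expR `|x| by rewrite -expR0 ler_expR.
have := ler_norm x; have := ler_norm (- x); rewrite normrN => ? ?.
rewrite ler_norml; apply/andP; split; nra.
Qed.

(** From [expR (- x) >= 1 - x] follows [expR x - 1 <= x * expR x], so the nonnegative remainder is
    at most [x * (expR x - 1)]. *)
Lemma norm_expRB1Bid_le x : `|expR x - 1 - x| <= x ^+ 2 * expR `|x|.
Proof.
have h1 := expR_ge1Dx x; have h2 := expR_ge1Dx (- x).
have h3 : expR x * expR (- x) = 1 by rewrite -expRD subrr expR0.
have e0 := expR_gt0 x.
have h : expR x - 1 - x <= x * (expR x - 1) by nra.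
rewrite ger0_norm; last by lra.
rewrite (le_trans h)// (le_trans (ler_norm _))// normrM -real_normK ?num_real//.
by rewrite expr2 -mulrA ler_wpM2l// norm_expRB1_le.
Qed.

Lemma cpowD a z w : cpow a (z + w) = cpow a z * cpow a w.
Proof.
case: z w => [z1 z2] [w1 w2]; rewrite /cpow /= !mulrDl expRD cosD sinD.
by apply/eqP; rewrite eq_complex /=; apply/andP; split; apply/eqP; ring.
Qed.

Lemma cpow1 z : cpow (1 : R) z = 1.
Proof. by rewrite /cpow ln1 /= !mulr0 expR0 cos0 sin0 mulr1 mulr0. Qed.

Lemma cpowM (a b : R) z : 0 < a -> 0 < b -> cpow (a * b) z = cpow a z * cpow b z.
Proof.
move=> a0 b0; rewrite /cpow lnM ?posrE// !mulrDr expRD cosD sinD.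
by apply/eqP; rewrite eq_complex /=; apply/andP; split; apply/eqP; ring.
Qed.

Lemma normc_cpow a z : normc (cpow a z) = expR (complex.Re z * ln a).
Proof.
rewrite /= !exprMn -mulrDr cos2Dsin2 mulr1 sqrtr_sqr ger0_norm//.
Qed.

Lemma cpow_real a (r : R) : cpow a (Complex r 0) = Complex (expR (r * ln a)) 0.
Proof. by rewrite /cpow /= mul0r cos0 sin0 mulr1 mulr0. Qed.

(** Writing [h * ln a = p + i t], both [|p|] and [|t|] are at most [N]; the real and the imaginary
    part of the remainder each contribute [2 * N ^+ 2 * expR N]. *)
Lemma normc_cpowB1Bid_le a h :
  normc (cpow a h - 1 - h * Complex (ln a) 0) <=
  4 * (normc h * `|ln a|) ^+ 2 * expR (normc h * `|ln a|).
Proof.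
rewrite (le_trans (normc_le_ReIm _))//.
set N := normc h * `|ln a|.
have pN : `|complex.Re h * ln a| <= N by rewrite normrM ler_wpM2r// Re_le_normc.
have tN : `|complex.Im h * ln a| <= N by rewrite normrM ler_wpM2r// Im_le_normc.
have -> : complex.Re (cpow a h - 1 - h * Complex (ln a) 0) =
    expR (complex.Re h * ln a) * cos (complex.Im h * ln a) - 1 - complex.Re h * ln a.
  by case: h {N pN tN} => h1 h2 /=; rewrite mulr0 subr0.
have -> : complex.Im (cpow a h - 1 - h * Complex (ln a) 0) =
    expR (complex.Re h * ln a) * sin (complex.Im h * ln a) - complex.Im h * ln a.
  by case: h {N pN tN} => h1 h2 /=; rewrite mulr0 add0r subr0.
move: pN tN; set p := complex.Re h * _; set t := complex.Im h * _; move: N p t.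
move=> N p t pN tN.
have N0 : 0 <= N by rewrite (le_trans _ pN).
have eN1 : 1 <= expR N by rewrite -expR0 ler_expR.
have ep : expR `|p| <= expR N by rewrite ler_expR.
have ep' : expR p <= expR N by rewrite (le_trans _ ep)// ler_expR ler_norm.
have p2 : p ^+ 2 <= N ^+ 2 by rewrite -real_normK ?num_real// lerXn2r ?nnegrE.
have t2 : t ^+ 2 <= N ^+ 2 by rewrite -real_normK ?num_real// lerXn2r ?nnegrE.
have h1 : `|expR p * cos t - 1 - p| <= 2 * N ^+ 2 * expR N.
  have -> : expR p * cos t - 1 - p = (expR p - 1 - p) + expR p * (cos t - 1) by ring.
  rewrite (le_trans (ler_normD _ _))// normrM (ger0_norm (expR_ge0 p)).
  have := norm_expRB1Bid_le p; have := norm_cosB1_le t.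
  have : p ^+ 2 * expR `|p| <= N ^+ 2 * expR N.
    by rewrite ler_pM ?sqr_ge0// expR_ge0.
  have : expR p * `|cos t - 1| <= expR N * N ^+ 2.
    by rewrite ler_pM ?expR_ge0// (le_trans (norm_cosB1_le _)).
  lra.
have h2 : `|expR p * sin t - t| <= 2 * N ^+ 2 * expR N.
  have -> : expR p * sin t - t = (expR p - 1) * sin t + (sin t - t) by ring.
  rewrite (le_trans (ler_normD _ _))// normrM.
  have : `|expR p - 1| * `|sin t| <= (N * expR N) * N.
    rewrite ler_pM// ?(le_trans (norm_sin_le _))//.
    by rewrite (le_trans (norm_expRB1_le _))// ler_pM// expR_ge0.
  (* The cubic bound leaves a spare factor [|t| <= N], absorbed by [N <= expR N]. *)
  have : `|sin t - t| <= N ^+ 2 * expR N.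
    rewrite (le_trans (norm_sinBid_le _))// exprSr real_normK ?num_real//.
    rewrite ler_pM ?sqr_ge0// (le_trans tN)// (le_trans _ (expR_ge1Dx _))//.
    by rewrite lerDr.
  nra.
lra.
Qed.

End ComplexPower.

(** * The factors of [Gamma (w + h) / Gamma w], with estimates uniform in [h] *)

Section GammaProduct.
Context {R : realType}.
Implicit Types (w h z : R[i]) (d : R).

Let ell (k : nat) : R := ln (k.+2%:R / k.+1%:R).

(** The logarithms telescope, so the first [n] terms sum to [ln (n + 1)] minus the sum of
    [1 / (w + k)] over [k < n]: the classical limit formula for the digamma function. *)
Definition digamma_term w k : R[i] := Complex (ln (k.+2%:R / k.+1%:R)) 0 - (w + k%:R)^-1.

Definition gamma_factor w h k : R[i] :=
  cpow (k.+2%:R / k.+1%:R) h * ((w + k%:R) / (w + k%:R + h)).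

(** Both halves are [ln (1 + x) <= x], at [x = 1 / (k + 1)] and, after inverting the quotient, at
    [x = - 1 / (k + 2)]. *)
Lemma lnS2_bounds k : k.+2%:R^-1 <= ell k <= k.+1%:R^-1.
Proof.
have h1 : 0 < k.+1%:R :> R by [].
have h2 : 0 < k.+2%:R :> R by [].
have E : k.+2%:R = k.+1%:R + 1 :> R by rewrite -natr1.
apply/andP; split.
  have := @le_ln1Dx R (- k.+2%:R^-1).
  have -> : 1 - k.+2%:R^-1 = (k.+2%:R / k.+1%:R)^-1 :> R.
    rewrite invf_div E; move: (k.+1%:R : R) h1 => x x0.
    by field; rewrite gt_eqF// addr_gt0.
  rewrite lnV ?posrE ?divr_gt0// lerN2; apply.
  by rewrite ltrN2 invf_lt1// ltr1n.
have := @le_ln1Dx R (k.+1%:R^-1).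
have -> : 1 + k.+1%:R^-1 = (k.+2%:R / k.+1%:R) :> R.
  rewrite E; move: (k.+1%:R : R) h1 => x x0; by field; rewrite gt_eqF.
by apply; rewrite (lt_le_trans (@ltrN10 R))// invr_ge0.
Qed.

(** Since [d <= 1], the real part of [w + k] is at least [d + k >= d * (k + 1)]; one constant thus
    serves for all [k]. *)
Lemma normc_invD_nat_le w d k : 0 < d <= 1 -> d <= complex.Re w ->
  normc (w + k%:R)^-1 <= (d * k.+1%:R)^-1.
Proof.
move=> /andP[d0 d1] dw; rewrite normcV.
have dk : 0 < d * k.+1%:R by rewrite mulr_gt0.
have dz : d * k.+1%:R <= normc (w + k%:R).
  rewrite (le_trans _ (Re_le_normc _))// (le_trans _ (ler_norm _))//.
  rewrite ReD Re_nat -natr1 mulrDr mulr1 addrC lerD//.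
  by rewrite ler_piMl.
by rewrite lef_pV2 ?posrE// (lt_le_trans dk).
Qed.

Lemma Re_gt0_neq0 w : 0 < complex.Re w -> w != 0.
Proof. by move=> w0; apply/eqP => we; move: w0; rewrite we ltxx. Qed.

Lemma Re_addnat_gt0 w k : 0 < complex.Re w -> 0 < complex.Re (w + k%:R).
Proof. by move=> w0; rewrite ReD Re_nat ltr_wpDr. Qed.

(** Both parts of the term are compared with [1 / (k + 1)]: the logarithm differs from it by at most
    [1 / (k + 1) ^ 2], and the reciprocal by [(w - 1) / ((k + 1) (w + k))]. *)
Lemma normc_digamma_term_le w d k : 0 < d <= 1 -> d <= complex.Re w ->
  normc (digamma_term w k) <= (1 + (normc w + 1) / d) * k.+1%:R ^- 2.
Proof.
move=> d01 dw; have d0 : 0 < d by case/andP: d01.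
have k1 : 0 < k.+1%:R :> R by [].
have wk : w + k%:R != 0.
  by rewrite Re_gt0_neq0// Re_addnat_gt0// (lt_le_trans d0).
have -> : digamma_term w k = Complex (ell k - k.+1%:R^-1) 0
    + (w - 1) * (Complex (k.+1%:R^-1) 0 * (w + k%:R)^-1).
  rewrite /digamma_term -/(ell k).
  have -> : Complex (ell k - k.+1%:R^-1) 0 = Complex (ell k) 0 - Complex (k.+1%:R^-1) 0.
    by apply/eqP; rewrite eq_complex /= subr0 !eqxx.
  have -> : Complex (k.+1%:R^-1) 0 = (k.+1%:R^-1 : R[i]).
    rewrite -[k.+1%:R in RHS](rmorph_nat (real_complex R)) -[RHS]fmorphV//.
  move: (Complex (ell k) 0) => x; rewrite -natr1; field.
  by rewrite wk /= natr1 pnatr_eq0.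
rewrite (le_trans (le_normcD _ _))// [leRHS]mulrDl mul1r lerD//.
  rewrite normc_real ler_norml.
  have /andP[l1 l2] := lnS2_bounds k.
  have E : k.+2%:R = k.+1%:R + 1 :> R by rewrite -natr1.
  have : k.+1%:R^-1 - k.+2%:R^-1 <= k.+1%:R ^- 2 :> R.
    have k2 : 0 < k.+1%:R + 1 :> R by rewrite -E.
    rewrite E; move: (k.+1%:R : R) k1 k2 => x x0 x2.
    rewrite -subr_ge0.
    have -> : x ^- 2 - (x^-1 - (x + 1)^-1) = (x ^+ 2 * (x + 1))^-1.
      by field; rewrite !gt_eqF.
    by rewrite invr_ge0 mulr_ge0 ?sqr_ge0 ?ltW.
  have : 0 <= k.+1%:R ^- 2 :> R by rewrite invr_ge0 sqr_ge0.
  move: l1 l2; move: (k.+1%:R^-1 : R) (k.+2%:R^-1 : R) (k.+1%:R ^- 2 : R) (ell k).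
  by move=> u v t l *; apply/andP; split; lra.
rewrite !normcM normc_real ger0_norm ?invr_ge0//.
have -> : (normc w + 1) / d * k.+1%:R ^- 2 =
    (normc w + 1) * (k.+1%:R^-1 * (d * k.+1%:R)^-1).
  by field; rewrite !gt_eqF.
rewrite ler_pM ?mulr_ge0 ?normc_ge0 ?invr_ge0//.
  by rewrite (le_trans (le_normcB _ _))// normc1.
by rewrite ler_wpM2l ?invr_ge0// normc_invD_nat_le.
Qed.

Lemma normc_gamma_factor_le w h d (M : R) k :
  0 < d <= 1 -> d <= complex.Re w -> d <= complex.Re (w + h) -> normc h <= M ->
  normc (gamma_factor w h k - 1 - h * digamma_term w k) <=
  (4 * expR M * (1 + M / d) + d^-1 + d ^- 2) * normc h ^+ 2 * k.+1%:R ^- 2.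
Proof.
move=> d01 dw dwh hM; have d0 : 0 < d by case/andP: d01.
have k1 : 0 < k.+1%:R :> R by [].
have wk : w + k%:R != 0.
  by rewrite Re_gt0_neq0// Re_addnat_gt0// (lt_le_trans d0).
have whkE : w + k%:R + h = w + h + k%:R by rewrite addrAC.
have whk : w + k%:R + h != 0.
  by rewrite whkE Re_gt0_neq0// Re_addnat_gt0// (lt_le_trans d0).
have i1 := normc_invD_nat_le _ _ k d01 dw.
have i2 := normc_invD_nat_le _ _ k d01 dwh.
rewrite -whkE in i2.
set rho := cpow (k.+2%:R / k.+1%:R) h - 1 - h * Complex (ell k) 0.
(* Multiply [1 + h * ell k + rho] by [1 - h / (w + k + h)]: once the linear terms are removed, these
   three remain, each of order [h ^ 2 / (k + 1) ^ 2]. In this order they give the three summands of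
   the constant. *)
have -> : gamma_factor w h k - 1 - h * digamma_term w k =
  rho * (1 - h * (w + k%:R + h)^-1) - h * Complex (ell k) 0 * (h * (w + k%:R + h)^-1)
   + h ^+ 2 * ((w + k%:R)^-1 * (w + k%:R + h)^-1).
  rewrite /rho /gamma_factor /digamma_term -/(ell k).
  move: (Complex (ell k) 0) (cpow _ h) => x y; field.
  by rewrite wk whk.
have x0 : 0 <= k.+1%:R^-1 :> R by rewrite invr_ge0.
have xle1 : k.+1%:R^-1 <= 1 :> R by rewrite invf_le1// ler1n.
have ek : `|ell k| <= k.+1%:R^-1.
  have /andP[l1 l2] := lnS2_bounds k.
  by rewrite ger0_norm// (le_trans _ l1)// invr_ge0.
have M0 : 0 <= M by rewrite (le_trans (normc_ge0 h)).
have di0 : 0 <= d^-1 by rewrite invr_ge0 ltW.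
have hn := normc_ge0 h.
have hrho : normc rho <= 4 * expR M * normc h ^+ 2 * k.+1%:R ^- 2.
  rewrite (le_trans (normc_cpowB1Bid_le _ _))// -/(ell k).
  have -> : 4 * expR M * normc h ^+ 2 * k.+1%:R ^- 2 =
    4 * (normc h * k.+1%:R^-1) ^+ 2 * expR M.
    by rewrite exprMn exprVn; ring.
  rewrite ler_pM ?expR_ge0 ?mulr_ge0 ?sqr_ge0//.
    rewrite ler_wpM2l// lerXn2r ?nnegrE ?mulr_ge0//.
    by rewrite ler_wpM2l.
  rewrite ler_expR -[leRHS]mulr1 ler_pM//.
  by rewrite (le_trans ek).
rewrite invfM in i1 i2.
rewrite (le_trans (le_normcD _ _))// (le_trans (lerD (le_normcB _ _) (lexx _)))//.
rewrite !normcM normc_real -exprVn.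
rewrite -exprVn in hrho.
move: x0 xle1 ek hrho i1 i2 => {k1 wk whk whkE}.
move: (k.+1%:R^-1) => x x0 x1 ek hrho i1 i2.
have q1 : normc (1 - h * (w + k%:R + h)^-1) <= 1 + M / d.
  rewrite (le_trans (le_normcB _ _))// normc1 lerD2l normcM ler_pM ?normc_ge0//.
  by rewrite (le_trans i2)// -[leRHS]mulr1 ler_wpM2l.
have e1 : normc rho * normc (1 - h / (w + k%:R + h)) <=
   (4 * expR M * normc h ^+ 2 * x ^+ 2) * (1 + M / d).
  by rewrite ler_pM ?normc_ge0.
have e2 : normc h * `|ell k| * (normc h * normc (w + k%:R + h)^-1)
   <= normc h * x * (normc h * (d^-1 * x)).
  by rewrite ler_pM ?mulr_ge0 ?normc_ge0// ler_wpM2l.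
have e3 : normc h * normc h * (normc (w + k%:R)^-1 * normc (w + k%:R + h)^-1)
  <= normc h * normc h * ((d^-1 * x) * (d^-1 * x)).
  by rewrite ler_wpM2l ?mulr_ge0// ler_pM ?normc_ge0.
rewrite [leLHS]addrC; apply: (le_trans (lerD e3 (lerD e1 e2))).
rewrite -exprVn le_eqVlt; apply/orP; left; apply/eqP; ring.
Qed.

(** The constant depends on neither [h] nor [n], so the estimate survives the limit in [n] and then
    yields a derivative in [h]. *)
Lemma normc_gamma_prod_le w d (M : R) : 0 < d <= 1 -> d <= complex.Re w -> 0 <= M ->
  exists C : R, forall h, d <= complex.Re (w + h) -> normc h <= M ->
  cvgn (fun n => \prod_(k < n) gamma_factor w h k) /\
  forall n, normc (\prod_(k < n) gamma_factor w h k - 1 -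
      h * \sum_(k < n) digamma_term w k) <= C * normc h ^+ 2.
Proof.
move=> d01 dw M0.
set C1 := 4 * expR M * (1 + M / d) + d^-1 + d ^- 2.
set C2 := 1 + (normc w + 1) / d.
have d0 : 0 < d by case/andP: d01.
have C10 : 0 <= C1.
  by rewrite !addr_ge0 ?mulr_ge0 ?invr_ge0 ?sqr_ge0 ?expR_ge0 ?addr_ge0 ?divr_ge0// ltW.
have C20 : 0 <= C2 by rewrite !addr_ge0// divr_ge0 ?ltW// ltr_wpDl// normc_ge0.
(* [(C1 * M + C2) * normc h] bounds [(k + 1) ^ 2] times the modulus of [a k], one factor [normc h]
   of the quadratic term being replaced by [M]; the 2 bounds the sum of the inverse squares. *)
pose E0 := 2 * (C1 * M + C2).
have E00 : 0 <= E0 by rewrite mulr_ge0// addr_ge0// mulr_ge0.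
(* The first summand bounds the product minus its first-order part, the second the accumulated
   remainders of the single factors. *)
exists (E0 ^+ 2 * expR (E0 * M) + 2 * C1) => h dwh hM.
have hn := normc_ge0 h.
pose a k := gamma_factor w h k - 1.
have a1 k : normc (a k - h * digamma_term w k) <= C1 * normc h ^+ 2 * k.+1%:R ^- 2.
  exact: normc_gamma_factor_le.
pose e k : R := (C1 * M + C2) * normc h * k.+1%:R ^- 2.
have ae k : normc (a k) <= e k.
  have -> : a k = (a k - h * digamma_term w k) + h * digamma_term w k by rewrite subrK.
  rewrite (le_trans (le_normcD _ _))// normcM (le_trans (lerD (a1 k) (lexx _)))//.
  have t2 := normc_digamma_term_le _ _ k d01 dw; rewrite -/C2 in t2.
  have k0 : 0 <= k.+1%:R ^- 2 :> R by rewrite invr_ge0 sqr_ge0.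
  have : normc h * normc (digamma_term w k) <= normc h * (C2 * k.+1%:R ^- 2).
    by rewrite ler_wpM2l.
  have : C1 * normc h ^+ 2 * k.+1%:R ^- 2 <= C1 * M * normc h * k.+1%:R ^- 2.
    by rewrite ler_wpM2r// expr2 mulrA ler_wpM2r// ler_wpM2l.
  rewrite /e; move: (k.+1%:R ^- 2 : R) k0 (normc (digamma_term w k)) => x x0 u * ; nra.
have Se n : \sum_(k < n) e k <= E0 * normc h.
  rewrite /e -mulr_sumr /E0.
  have -> : 2 * (C1 * M + C2) * normc h = (C1 * M + C2) * normc h * 2 by ring.
  by rewrite ler_wpM2l ?sum_inv_square_le2// mulr_ge0// addr_ge0// mulr_ge0.
have Pa n : \prod_(k < n) gamma_factor w h k = \prod_(k < n) (1 + a k).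
  by apply: eq_bigr => k _; rewrite /a addrC subrK.
split.
  under [X in cvgn X]eq_fun do rewrite Pa.
  exact: (is_cvg_prod1D _ _ ae _ Se).
move=> n; rewrite Pa.
have -> : \prod_(k < n) (1 + a k) - 1 - h * \sum_(k < n) digamma_term w k =
   (\prod_(k < n) (1 + a k) - 1 - \sum_(k < n) a k) +
   \sum_(k < n) (a k - h * digamma_term w k).
  rewrite [X in _ = _ + X]sumrB -mulr_sumr; move: (\sum_(k < n) a k) => x; ring.
rewrite (le_trans (le_normcD _ _))// [leRHS]mulrDl lerD//.
  rewrite (le_trans (normc_prod1D_sub2 _ _ ae n))//.
  set S := \sum_(k < n) e k.
  have S0 : 0 <= S by apply: sumr_ge0 => k _; rewrite (le_trans (normc_ge0 _) (ae k)).
  rewrite (le_trans (ler_norm _))// (le_trans (norm_expRB1Bid_le S))//.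
  rewrite ger0_norm// [leRHS]mulrAC ler_pM ?expR_ge0 ?sqr_ge0//.
    rewrite -exprMn lerXn2r ?nnegrE ?(mulr_ge0 E00)//; exact: Se.
  by rewrite ler_expR (le_trans (Se n))// ler_wpM2l.
have -> : 2 * C1 * normc h ^+ 2 = C1 * normc h ^+ 2 * 2 by ring.
have normc_sum (I : Type) (r : seq I) (F : I -> R[i]) :
    normc (\sum_(i <- r) F i) <= \sum_(i <- r) normc (F i).
  elim/big_ind2 : _ => [|x1 x2 y1 y2 ? ?|//]; first by rewrite normc0.
  by rewrite (le_trans (le_normcD _ _))// lerD.
rewrite (le_trans (normc_sum _ _ _))//.
apply: (@le_trans _ _ (\sum_(k < n) C1 * normc h ^+ 2 * k.+1%:R ^- 2)).
  by apply: ler_sum => k _.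
by rewrite -mulr_sumr ler_wpM2l ?sum_inv_square_le2// mulr_ge0// sqr_ge0.
Qed.

End GammaProduct.

(** * Convergence of Gauss's limit and the logarithmic derivative of [Gamma] *)

Section DigammaLimit.
Context {R : realType}.
Implicit Types (w h z : R[i]).

Definition gauss_seq z n : R[i] :=
  (n`!)%:R * cpow n%:R z / \prod_(k < n.+1) (z + k%:R).

Lemma prod_cpow_telescope h m :
  \prod_(k < m) cpow (k.+2%:R / k.+1%:R : R) h = cpow m.+1%:R h.
Proof.
elim: m => [|m IH]; first by rewrite big_ord0 cpow1.
by rewrite big_ord_recr/= IH -cpowM ?divr_gt0// mulrC divfK// pnatr_eq0.
Qed.

Lemma prod_addnat_neq0 w m : 0 < complex.Re w -> \prod_(k < m) (w + k%:R) != 0.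
Proof.
move=> w0; rewrite prodf_seq_neq0; apply/allP => k _ /=.
by rewrite Re_gt0_neq0// Re_addnat_gt0.
Qed.

(** The powers in the [n + 1] factors telescope to [(n + 2) ^ h], whereas Gauss's sequence carries
    [n ^ h]; the correction [(n / (n + 2)) ^ h] tends to 1. *)
Lemma gauss_seq_shift w h n : (0 < n)%N ->
  0 < complex.Re w -> 0 < complex.Re (w + h) ->
  gauss_seq (w + h) n = gauss_seq w n *
    (cpow (n%:R / n.+2%:R) h * \prod_(k < n.+1) gamma_factor w h k).
Proof.
move=> n0 w0 wh0.
rewrite big_split/= prod_cpow_telescope prodf_div.
have -> : \prod_(k < n.+1) (w + k%:R + h) = \prod_(k < n.+1) (w + h + k%:R).
  by apply: eq_bigr => k _; rewrite addrAC.
rewrite [cpow (n%:R / _) h * _]mulrA -cpowM ?divr_gt0 ?ltr0n// divfK ?pnatr_eq0// /gauss_seq cpowD.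
have := prod_addnat_neq0 _ n.+1 w0; have := prod_addnat_neq0 _ n.+1 wh0.
move: (\prod_(k < n.+1) (w + k%:R)) (\prod_(k < n.+1) (w + h + k%:R)) => x y y0 x0.
by move: (cpow n%:R w) (cpow n%:R h) => u v; field; rewrite x0 y0.
Qed.

Lemma gauss_seq1 n : (0 < n)%N -> gauss_seq 1 n = (n%:R / n.+1%:R : R[i]).
Proof.
move=> n0; rewrite /gauss_seq.
have -> : \prod_(k < n.+1) (1 + k%:R) = (n.+1)`!%:R :> R[i].
  rewrite fact_prod natr_prod big_add1 /= big_mkord.
  by apply: eq_bigr => k _; rewrite addrC natr1.
have -> : cpow (n%:R : R) 1 = n%:R.
  rewrite (cpow_real n%:R 1) mul1r lnK ?posrE ?ltr0n//.
  by rewrite -[RHS](rmorph_nat (real_complex R)).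
have f0 : n`!%:R != 0 :> R[i] by rewrite pnatr_eq0 -lt0n fact_gt0.
by rewrite factS mulnC natrM invfM mulrACA mulfV// mul1r.
Qed.

Lemma cvg_natdivD (j : nat) : (n%:R / (n + j)%:R : R) @[n --> \oo] --> (1 : R).
Proof.
have h : (1 - j%:R * (n.+1%:R^-1) : R) @[n --> \oo] --> (1 : R).
  rewrite -[X in _ --> X]subr0; apply: cvgB; first exact: cvg_cst.
  rewrite -(mulr0 j%:R); apply: cvgM; first exact: cvg_cst.
  exact: cvg_harmonic.
rewrite -(cvg_shiftS (fun n => n%:R / (n + j)%:R : R)).
(* With [m = n + 1], the lower bound comes from [(1 - j / m) * (m + j) = m - j ^ 2 / m <= m]. *)
apply: (@squeeze_cvgr _ _ _ _ (fun n => 1 - j%:R * n.+1%:R^-1 : R) (cst 1)) => //.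
- near=> n; apply/andP; split.
    rewrite ler_pdivlMr ?ltr0n// natrD.
    have n0 : 0 < n.+1%:R :> R by [].
    have j0 : 0 <= j%:R :> R by [].
    have -> : (1 - j%:R / n.+1%:R) * (n.+1%:R + j%:R) =
       n.+1%:R - j%:R ^+ 2 / n.+1%:R :> R.
      by move: (n.+1%:R : R) (j%:R : R) n0 => x y x0; field; rewrite gt_eqF.
    by rewrite gerBl divr_ge0 ?sqr_ge0.
  by rewrite ler_pdivrMr ?ltr0n// mul1r ler_nat leq_addr.
- exact: cvg_cst.
Unshelve. all: by end_near. Qed.

Lemma cvg_cpow_1 (a : nat -> R) h : a @ \oo --> (1 : R) ->
  cpow (a n) h @[n --> \oo] --> (1 : R[i]).
Proof.
move=> a1.
have l0 : ln (a n) @[n --> \oo] --> (0 : R).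
  by rewrite -ln1; apply: (cvg_comp _ _ a1); exact: continuous_ln.
have e0 : expR (complex.Re h * ln (a n)) @[n --> \oo] --> (1 : R).
  rewrite -expR0 -(mulr0 (complex.Re h)).
  apply: continuous_cvg; first exact: continuous_expR.
  by apply: cvgM => //; exact: cvg_cst.
have t0 : complex.Im h * ln (a n) @[n --> \oo] --> (0 : R).
  by rewrite -(mulr0 (complex.Im h)); apply: cvgM => //; exact: cvg_cst.
rewrite (_ : 1 = Complex 1 0)//; apply: cvgc_ReIm => /=.
  rewrite -[X in _ --> X](mulr1 1); apply: cvgM => //.
  by rewrite -[X in _ --> X]cos0; apply: continuous_cvg => //; exact: continuous_cos.
rewrite -[X in _ --> X](mulr0 1); apply: cvgM => //.
by rewrite -[X in _ --> X]sin0; apply: continuous_cvg => //; exact: continuous_sin.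
Qed.

Lemma is_cvg_gamma_prod w h : 0 < complex.Re w -> 0 < complex.Re (w + h) ->
  cvgn (fun n => \prod_(k < n) gamma_factor w h k).
Proof.
move=> w0 wh0.
pose d := Num.min 1 (Num.min (complex.Re w) (complex.Re (w + h))).
have d01 : 0 < d <= 1 by rewrite /d !lt_min ltr01 w0 wh0 /= ge_min lexx.
have dw : d <= complex.Re w by rewrite /d !ge_min lexx orbT.
have dwh : d <= complex.Re (w + h) by rewrite /d !ge_min lexx !orbT.
have [C /(_ h dwh (lexx _))[]] := normc_gamma_prod_le _ _ _ d01 dw (normc_ge0 h).
by [].
Qed.

Lemma cvg_gauss_seq_shift w h (l : R[i]) : 0 < complex.Re w -> 0 < complex.Re (w + h) ->
  gauss_seq w @ \oo --> l ->
  gauss_seq (w + h) @ \oo --> l * limn (fun n => \prod_(k < n) gamma_factor w h k).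
Proof.
move=> w0 wh0 wl.
have P := is_cvg_gamma_prod _ _ w0 wh0.
have : gauss_seq w n * (cpow (n%:R / n.+2%:R) h * \prod_(k < n.+1) gamma_factor w h k)
    @[n --> \oo] --> l * (1 * limn (fun n => \prod_(k < n) gamma_factor w h k)).
  have c1 : cpow (n%:R / n.+2%:R) h @[n --> \oo] --> (1 : R[i]).
    by apply: cvg_cpow_1; under eq_fun do rewrite -addn2; exact: cvg_natdivD.
  have c2 := P; rewrite -(cvg_shiftS (fun n => \prod_(k < n) gamma_factor w h k)) in c2.
  exact: (cvgM wl (cvgM c1 c2)).
rewrite mul1r; apply: cvg_trans; apply: near_eq_cvg; near=> n.
rewrite gauss_seq_shift//.
by near: n; exact: nbhs_infty_gt.
Unshelve. all: by end_near. Qed.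

Lemma cvg_gauss_seq1 : gauss_seq 1 @ \oo --> (1 : R[i]).
Proof.
have : (n%:R / n.+1%:R : R[i]) @[n --> \oo] --> (1 : R[i]).
  apply: (@cvg_trans _ ((fun n => Complex (n%:R / (n + 1)%:R : R) 0) @ \oo)).
    apply: near_eq_cvg; near=> n; rewrite addn1.
    rewrite -!(rmorph_nat (real_complex R)) -fmorph_div//.
  rewrite (_ : 1 = Complex 1 0)//; apply: cvgc_ReIm => /=.
    exact: cvg_natdivD.
  exact: cvg_cst.
apply: cvg_trans; apply: near_eq_cvg; near=> n.
rewrite gauss_seq1//.
by near: n; exact: nbhs_infty_gt.
Unshelve. all: by end_near. Qed.

(** The sequence is explicit at 1, and the shift by [z - 1] carries its convergence to the right
    half-plane. This makes the [lim] that defines [Gamma] a genuine limit there. *)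
Lemma cvg_Gamma z : 0 < complex.Re z -> gauss_seq z @ \oo --> Gamma z.
Proof.
move=> z0.
have := cvg_gauss_seq_shift 1 (z - 1) 1 _ _ cvg_gauss_seq1.
rewrite addrC subrK => /(_ ltr01 z0) h.
exact: (cvgP _ h).
Qed.

Lemma Gamma_shift w h : 0 < complex.Re w -> 0 < complex.Re (w + h) ->
  Gamma (w + h) = Gamma w * limn (fun n => \prod_(k < n) gamma_factor w h k).
Proof.
move=> w0 wh0; apply: (cvg_unique _ (cvg_Gamma _ wh0)) => //.
exact: cvg_gauss_seq_shift (cvg_Gamma _ w0).
Qed.

(** Shifting from [z] to 1 writes [Gamma 1 = 1] as a multiple of [Gamma z]. *)
Lemma Gamma_neq0 z : 0 < complex.Re z -> Gamma z != 0.
Proof.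
move=> z0.
have : Gamma 1 = 1 :> R[i].
  by apply: (cvg_unique _ (cvg_Gamma 1 ltr01) cvg_gauss_seq1).
have -> : 1 = z + (1 - z) by rewrite addrC subrK.
rewrite Gamma_shift ?(addrC z) ?subrK ?ltr01// => E.
by apply/eqP => Gz; move/eqP: E; rewrite Gz mul0r eq_sym oner_eq0.
Qed.

(** A quadratic bound on [Gamma (z + h) - Gamma z - Gamma z * l * h] identifies the derivative as
    [Gamma z * l]; nonvanishing of [Gamma z] then allows the division. *)
Lemma digamma_lim z (l : R[i]) : 0 < complex.Re z ->
  (\sum_(k < n) digamma_term z k) @[n --> \oo] --> l -> digamma z = l.
Proof.
move=> z0 Ll.
(* For [normc h <= Re z / 2] the real part of [z + h] is at least [Re z / 2 >= d], so one constant
   [C] covers a whole disc. *)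
pose d := Num.min 1 (complex.Re z / 2).
have d01 : 0 < d <= 1 by rewrite /d lt_min ltr01 divr_gt0//= ge_min lexx.
have dz2 : d <= complex.Re z / 2 by rewrite /d ge_min lexx orbT.
have dz : d <= complex.Re z by lra.
have [C HC] := normc_gamma_prod_le _ _ (complex.Re z / 2) d01 dz (ltac:(lra)).
have bound h : normc h <= complex.Re z / 2 ->
    normc (Gamma (z + h) - Gamma z - Gamma z * l * h) <=
    normc (Gamma z) * C * normc h ^+ 2.
  move=> hz.
  have zh : complex.Re z / 2 <= complex.Re (z + h).
    have := Re_le_normc h; rewrite ler_norml ReD => /andP[]; lra.
  have [Pc Pb] := HC h (le_trans dz2 zh) hz.
  rewrite Gamma_shift//; last by lra.
  set P := limn _.
  have -> : Gamma z * P - Gamma z - Gamma z * l * h = Gamma z * (P - 1 - h * l).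
    by ring.
  rewrite normcM -mulrA ler_wpM2l ?normc_ge0//.
  (* The bound on the partial products passes to their limit [P], while the partial sums tend to
     [l]. *)
  have c : normc (\prod_(k < n) gamma_factor z h k - 1 -
      h * \sum_(k < n) digamma_term z k) @[n --> \oo] --> normc (P - 1 - h * l).
    apply: cvg_normc.
    exact: (cvgB (cvgB Pc (cvg_cst (1 : R[i]))) (cvgM (cvg_cst h) Ll)).
  rewrite -(cvg_lim (@Rhausdorff R) c); apply: limr_le; first exact: (cvgP _ c).
  by near=> n; exact: Pb.
have D : h^-1 *: (Gamma (h + z) - Gamma z) @[h --> 0^'] --> Gamma z * l.
  apply/cvgc_normP.
  have nh0 : normc (Gamma z) * C * normc h @[h --> (0 : R[i])^'] --> (0 : R).
    rewrite -[X in _ --> X](mulr0 (normc (Gamma z) * C)).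
    apply: cvgM; first exact: cvg_cst.
    by rewrite -[X in _ --> X](@normc0 R); apply: cvg_normc; exact: nbhs_dnbhs.
  apply: (@squeeze_cvgr _ _ _ _ (cst 0) (fun h => normc (Gamma z) * C * normc h));
    [|exact: cvg_cst|exact: nh0].
  near=> h; rewrite normc_ge0/=.
  have h0 : h != 0 by near: h; exact: nbhs_dnbhs_neq.
  have hz : normc h <= complex.Re z / 2.
    near: h.
    have /cvgrPdist_le : normc h @[h --> (0 : R[i])^'] --> (0 : R).
      by rewrite -[X in _ --> X](@normc0 R); apply: cvg_normc; exact: nbhs_dnbhs.
    have z2 : 0 < complex.Re z / 2 by rewrite divr_gt0.
    move=> /(_ _ z2); apply: filterS => h.
    by rewrite sub0r normrN ger0_norm ?normc_ge0.
  have -> : h^-1 *: (Gamma (h + z) - Gamma z) - Gamma z * l =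
      h^-1 * (Gamma (z + h) - Gamma z - Gamma z * l * h).
    rewrite [h + z]addrC /GRing.scale/= [RHS]mulrBr; congr (_ - _).
    by rewrite [RHS]mulrC mulfK.
  rewrite normcM normcV.
  have nh : 0 < normc h.
    rewrite lt_def normc_ge0 andbT; apply: contra_neq h0; exact: eq0_normc.
  by rewrite mulrC ler_pdivrMr// (le_trans (bound _ hz))// expr2 !mulrA.
have -> : digamma z = derive1 (@Gamma R) z / Gamma z by [].
by rewrite /derive1 (cvg_lim _ D)// mulrAC mulfV ?mul1r ?Gamma_neq0.
Unshelve. all: by end_near. Qed.

End DigammaLimit.

(** * Integrals of complex powers over the unit interval *)

Section PowerIntegrals.
Context {R : realType}.
Local Notation mu := (@lebesgue_measure R).
Implicit Types (x a b d r : R) (c z w : R[i]).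

Lemma derivable_continuous_within (F : R -> R) (A : set R) :
  (forall x, A x -> derivable F x 1) -> {within A, continuous F}.
Proof.
move=> dF; apply: continuous_in_subspaceT => x; rewrite inE => Ax.
by apply: differentiable_continuous; apply/derivable1_diffP; exact: dF.
Qed.

(* The interval ]0, 1] is exhausted by the segments [exp(-n), 1], on which the integrand
   has no singularity. *)
Lemma ge0_FTC2_oo01 (f F : R -> R) (l : R) :
  (forall x, 0 < x -> is_derive x 1 F (f x)) ->
  (forall x, 0 < x -> derivable f x 1) ->
  (forall x, 0 < x <= 1 -> 0 <= f x) ->
  F (expR (- n%:R)) @[n --> \oo] --> l ->
  (\int[mu]_(x in `]0%R, 1%R[) (f x)%:E = (F 1 - l)%:E)%E.
Proof.
move=> dF df f0 Fl.
have mf : measurable_fun (`]0%R, 1%R] : set R) f.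
  apply: subspace_continuous_measurable_fun => //.
  apply: derivable_continuous_within => x /=.
  by rewrite in_itv/= => /andP[x0 _]; exact: df.
have -> : (\int[mu]_(x in `]0%R, 1%R[) (f x)%:E = \int[mu]_(x in `]0%R, 1%R]) (f x)%:E)%E.
  apply: integral_itv_bndo_bndc; apply/measurable_EFinP.
  by apply: measurable_funS mf => //; apply: subset_itvl; rewrite bnd_simp.
pose G n : set R := `[expR (- n%:R), 1]%classic.
have GE : \bigcup_n G n = `]0, 1]%classic.
  apply/seteqP; split => x /=.
    move=> [n _]; rewrite /G /= !in_itv/= => /andP[h ->]; rewrite andbT.
    by rewrite (lt_le_trans _ h)// expR_gt0.
  (* [expR (- n) <= x] amounts to [- ln x <= n], whence the truncation of [|ln x|] plus one. *)
  rewrite in_itv/= => /andP[x0 x1]; exists (Num.truncn `|ln x|).+1 => //.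
  rewrite /G /= in_itv/= x1 andbT -{2}(lnK x0) ler_expR lerNl.
  rewrite (le_trans (ler_norm _))// normrN ltW//.
  by have /andP[] := @truncn_itv R `|ln x| (normr_ge0 _).
have Gsub n : G n `<=` `]0, 1]%classic by rewrite -GE; exact: bigcup_sup.
have h : (\int[mu]_(x in G n) (f x)%:E)%E @[n --> \oo] -->
    (\int[mu]_(x in \bigcup_n G n) (f x)%:E)%E.
  apply: ge0_nondecreasing_set_cvg_integral => //.
  - move=> m n mn; rewrite subsetEset; apply: subset_itvr.
    by rewrite bnd_simp ler_expR lerN2 ler_nat.
  - by move=> n; exact: measurable_itv.
  - by move=> n; apply/measurable_EFinP; apply: measurable_funS mf.
  - move=> n x /Gsub; rewrite /= in_itv/= => x01; rewrite lee_fin; exact: f0.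
rewrite GE in h.
apply: (cvg_unique _ h) => //=.
have : (F 1 - F (expR (- n%:R)))%:E @[n --> \oo] --> (F 1 - l)%:E.
  apply: cvg_EFin; first exact: nearW.
  by apply: cvgB => //; exact: cvg_cst.
apply: cvg_trans; apply: near_eq_cvg; near=> n.
have n0 : (0 < n)%N by near: n; exact: nbhs_infty_gt.
have en1 : expR (- n%:R) < 1 :> R by rewrite expR_lt1 oppr_lt0 ltr0n.
rewrite (@continuous_FTC2 _ f F)//.
- apply: derivable_continuous_within => x /=; rewrite in_itv/= => /andP[x0 _].
  by apply: df; rewrite (lt_le_trans _ x0)// expR_gt0.
- have : {within `[expR (- n%:R), 1], continuous F}.
    apply: derivable_continuous_within => x /=; rewrite in_itv/= => /andP[x0 _].
    by apply: ex_derive; apply: dF; rewrite (lt_le_trans _ x0)// expR_gt0.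
  move=> /(continuous_within_itvP _ en1)[_ ? ?]; split => //.
  move=> x; rewrite in_itv/= => /andP[x0 _].
  by apply: ex_derive; apply: dF; rewrite (lt_trans _ x0)// expR_gt0.
- move=> x; rewrite in_itv/= => /andP[x0 _]; rewrite derive1E.
  have /dF := lt_trans (expR_gt0 _) x0.
  by move/@derive_val.
Unshelve. all: by end_near. Qed.

(** In the variable [v = ln x] the real part is an elementary real function [k], so the real chain
    rule applies; the factor [1 / x] coming from [ln] becomes [cpow x (- 1)]. *)
Lemma is_derive_cpow c z x : 0 < x ->
  is_derive x 1 (fun x => complex.Re (c * cpow x z))
    (complex.Re (c * z * cpow x (z - 1))).
Proof.
move=> x0; case: c z => [c1 c2] [a b].
pose k v := expR (a * v) * (c1 * cos (b * v) - c2 * sin (b * v)).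
pose k' v := expR (a * v) * (a * (c1 * cos (b * v) - c2 * sin (b * v))
   - b * (c1 * sin (b * v) + c2 * cos (b * v))).
have kd (v : R) : is_derive v 1 k (k' v).
  rewrite /k; apply: is_derive_eq; rewrite /k' /GRing.scale/=; ring.
have -> : (fun x => complex.Re (Complex c1 c2 * cpow x (Complex a b))) = k \o (@ln R).
  by apply/funext => y /=; rewrite /k; ring.
have dl := is_derive1_ln x0.
apply: (is_derive_eq (is_derive1_comp (kd (ln x)) dl)).
rewrite cpowD (_ : -1 = Complex (- 1) 0); last first.
  by apply/eqP; rewrite eq_complex /= oppr0 !eqxx.
rewrite cpow_real mulN1r expRN lnK// /= /k' /GRing.scale/=; ring.
Qed.

(* Adding the multiple of the modulus makes the real part of a complex power nonnegative,
   so that only the nonnegative versions of Tonelli and of the fundamental theorem are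
   needed. *)
Definition Qpow c d z x := complex.Re (c * cpow x (z - 1)) + d * expR ((complex.Re z - 1) * ln x).

Lemma Qpow_ge0 c d z x : normc c <= d -> 0 <= Qpow c d z x.
Proof.
move=> cd; rewrite /Qpow.
have h := Re_le_normc (c * cpow x (z - 1)).
rewrite normcM normc_cpow ReD ReN/= in h.
have h2 : normc c * expR ((complex.Re z - 1) * ln x) <= d * expR ((complex.Re z - 1) * ln x).
  by rewrite ler_wpM2r// expR_ge0.
move: h; rewrite ler_norml => /andP[h _]; lra.
Qed.

(** The modulus term is itself a complex power with real exponent, so facts on [cpow] apply to both
    summands. *)
Lemma QpowE c d z x : Qpow c d z x =
  complex.Re (c * cpow x (z - 1)) +
  complex.Re (Complex d 0 * cpow x (Complex (complex.Re z) 0 - 1)).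
Proof.
rewrite /Qpow; congr (_ + _).
rewrite (_ : Complex (complex.Re z) 0 - 1 = Complex (complex.Re z - 1) 0); last first.
  by apply/eqP; rewrite eq_complex /= oppr0 addr0 !eqxx.
by rewrite cpow_real /= mul0r subr0.
Qed.

Lemma integral_Qpow c d z : 0 < complex.Re z -> normc c <= d ->
  (\int[mu]_(x in `]0%R, 1%R[) (Qpow c d z x)%:E =
   (complex.Re (c / z) + d / complex.Re z)%:E)%E.
Proof.
move=> z0 cd.
have zn0 : z != 0 by exact: Re_gt0_neq0.
pose r := Complex (complex.Re z) 0.
have rn0 : r != 0 by exact: Re_gt0_neq0.
(* Real part of the antiderivative [c / z * x ^ z], plus its analogue for the modulus term; both
   tend to 0 at 0 because [Re z > 0]. *)
pose F x := complex.Re (c / z * cpow x z) + complex.Re (Complex d 0 / r * cpow x r).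
rewrite (_ : _ + _ = F 1 - 0); last first.
  rewrite /F !cpow1 !mulr1 subr0; congr (_ + _).
  rewrite (_ : Complex d 0 / r = Complex (d / complex.Re z) 0)//.
  exact/esym/(fmorph_div (real_complex R)).
apply: ge0_FTC2_oo01.
- move=> x x0; have h1 := is_derive_cpow (c / z) z x x0.
  have h2 := is_derive_cpow (Complex d 0 / r) r x x0.
  rewrite !divfK// in h1 h2.
  by rewrite QpowE; exact: is_deriveD.
- move=> x x0; rewrite (_ : Qpow c d z = (fun x => complex.Re (c * cpow x (z - 1))) +
      (fun x => complex.Re (Complex d 0 * cpow x (r - 1)))); last first.
    by apply/funext => y; rewrite QpowE.
  have [h1 _] := is_derive_cpow c (z - 1) x x0.
  have [h2 _] := is_derive_cpow (Complex d 0) (r - 1) x x0.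
  exact: derivableD.
- by move=> x _; exact: Qpow_ge0.
(* At [x = expR (- n)] the modulus of [x ^ z] is the geometric sequence [expR (- Re z) ^ n]. *)
- have e0 : expR (- complex.Re z) ^+ n @[n --> \oo] --> (0 : R).
    by apply: cvg_expr; rewrite ger0_norm ?expR_ge0// expR_lt1 oppr_lt0.
  have cv w c' : complex.Re w = complex.Re z ->
      complex.Re (c' * cpow (expR (- n%:R)) w) @[n --> \oo] --> (0 : R).
    move=> wz; apply: norm_cvg0.
    apply: (@squeeze_cvgr _ _ _ _ (cst 0) (fun n => normc c' * expR (- complex.Re z) ^+ n)).
    + near=> n; rewrite normr_ge0/= (le_trans (Re_le_normc _))// normcM normc_cpow.
      by rewrite wz expRK mulrN -mulNr mulr_natr -expRM_natr -mulr_natr.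
    + exact: cvg_cst.
    + by rewrite -(mulr0 (normc c')); apply: cvgM => //; exact: cvg_cst.
  by rewrite -[X in _ --> X](addr0 0); apply: cvgD; exact: cv.
Unshelve. all: by end_near. Qed.

End PowerIntegrals.

(** * Tonelli's theorem on measurable rectangles *)

Section TonelliRectangle.
Context {d1 d2 : measure_display} {T1 : measurableType d1} {T2 : measurableType d2}.
Context {R : realType}.
Variables (m1 : {sigma_finite_measure set T1 -> \bar R}).
Variables (m2 : {sigma_finite_measure set T2 -> \bar R}).
Variables (A : set T1) (B : set T2) (f : T1 * T2 -> \bar R).
Hypotheses (mA : measurable A) (mB : measurable B).
Hypothesis mf : measurable_fun setT f.
Hypothesis f0 : forall p, (A `*` B) p -> (0 <= f p)%E.

Let g := f \_ (A `*` B).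

Let mg : measurable_fun setT g.
Proof.
apply/(measurable_restrictT f); first exact: measurableX.
exact: measurable_funTS.
Qed.

Let g0 p : (0 <= g p)%E.
Proof. by rewrite /g patchE; case: ifPn => // /set_mem; exact: f0. Qed.

(** Tonelli's theorem on the whole product is applied to [g], the extension of [f] by 0 outside the
    rectangle; the inner integrals vanish for [x] outside [A]. *)
Lemma tonelli_rectangle1 : (\int[m1 \x m2]_(p in A `*` B) f p =
  \int[m1]_(x in A) \int[m2]_(y in B) f (x, y))%E.
Proof.
rewrite integral_mkcond fubini_tonelli1// [RHS]integral_mkcond.
apply: eq_integral => x _; rewrite /fubini_F patchE.
case: ifPn => [/set_mem Ax|/negP Ax].
  rewrite [RHS]integral_mkcond; apply: eq_integral => y _.
  rewrite /g !patchE; congr (if _ then _ else _).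
  by apply/idP/idP => [/set_mem[_ /mem_set]//|/set_mem By]; apply/mem_set.
apply: integral0_eq => y _; rewrite /g patchE ifF//.
by apply/negP => /set_mem[/= ? _]; apply: Ax; exact/mem_set.
Qed.

Lemma tonelli_rectangle2 : (\int[m1 \x m2]_(p in A `*` B) f p =
  \int[m2]_(y in B) \int[m1]_(x in A) f (x, y))%E.
Proof.
rewrite integral_mkcond fubini_tonelli2// [RHS]integral_mkcond.
apply: eq_integral => y _; rewrite /fubini_G patchE.
case: ifPn => [/set_mem By|/negP By].
  rewrite [RHS]integral_mkcond; apply: eq_integral => x _.
  rewrite /g !patchE; congr (if _ then _ else _).
  by apply/idP/idP => [/set_mem[/mem_set]//|/set_mem Ax]; apply/mem_set.
apply: integral0_eq => x _; rewrite /g patchE ifF//.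
by apply/negP => /set_mem[/= _ ?]; apply: By; exact/mem_set.
Qed.

End TonelliRectangle.

(** * Exchange of a double integral with a third one *)

Section TonelliTriple.
Context {d1 d2 d3 : measure_display} {T1 : measurableType d1} {T2 : measurableType d2}
  {T3 : measurableType d3} {R : realType}.
Variables (m1 : {sigma_finite_measure set T1 -> \bar R}).
Variables (m2 : {sigma_finite_measure set T2 -> \bar R}).
Variables (m3 : {sigma_finite_measure set T3 -> \bar R}).

(** Both exhausting sequences increase, so a point of [F i] times [G j] lies in the rectangle of
    index [maxn i j]. *)
Lemma sigma_finite_product : sigma_finite setT (m1 \x m2)%E.
Proof.
have /sigma_finiteP[F [FT Fnd Ffin]] := sigma_finiteT m1.
have /sigma_finiteP[G [GT Gnd Gfin]] := sigma_finiteT m2.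
exists (fun n => F n `*` G n).
  apply/seteqP; split => // -[x y] _.
  have [i _ Fx] : (\bigcup_i F i) x by rewrite -FT.
  have [j _ Gy] : (\bigcup_i G i) y by rewrite -GT.
  exists (maxn i j) => //; split => /=.
    by move/subsetPset: (Fnd _ _ (leq_maxl i j)); apply.
  by move/subsetPset: (Gnd _ _ (leq_maxr i j)); apply.
move=> n; have [mF Fn] := Ffin n; have [mG Gn] := Gfin n.
split; first exact: measurableX.
by rewrite product_measure1E// lte_mul_pinfty// ge0_fin_numE.
Qed.

Variables (A : set (T1 * T2)) (B : set T3) (f : (T1 * T2) * T3 -> \bar R).
Hypotheses (mA : measurable A) (mB : measurable B).
Hypothesis mf : measurable_fun setT f.
Hypothesis f0 : forall p, (A `*` B) p -> (0 <= f p)%E.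

(* The canonical sigma-finite structure on product measures is the one of
   subprobabilities, hence the explicit packing. *)
Lemma tonelli_triple : (\int[m1 \x m2]_(p in A) \int[m3]_(u in B) f (p, u) =
  \int[m3]_(u in B) \int[m1 \x m2]_(p in A) f (p, u))%E.
Proof.
pose m12 : {sigma_finite_measure set (T1 * T2)%type -> \bar R} :=
  HB.pack_for {sigma_finite_measure set (T1 * T2)%type -> \bar R} (m1 \x m2)%E
    (Measure_isSigmaFinite.Build _ _ _ (m1 \x m2)%E sigma_finite_product).
have h1 := @tonelli_rectangle1 _ _ _ _ R m12 m3 A B f mA mB mf f0.
have h2 := @tonelli_rectangle2 _ _ _ _ R m12 m3 A B f mA mB mf f0.
exact: etrans (esym h1) h2.
Qed.

End TonelliTriple.

(** * Integrals over the half-line in the exponent [u] *)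

Section LaplaceTransform.
Context {R : realType}.
Local Notation mu := (@lebesgue_measure R).
Implicit Types (x a b d r u : R) (c z w : R[i]).

Lemma ge0_FTC2_0y (f F : R -> R) (l : R) :
  (forall u, 0 <= u -> is_derive u 1 F (f u)) ->
  (forall u, 0 <= u -> derivable f u 1) ->
  (forall u, 0 <= u -> 0 <= f u) ->
  F u @[u --> +oo] --> l ->
  (\int[mu]_(u in `[0%R, +oo[) (f u)%:E = (l - F 0)%:E)%E.
Proof.
move=> dF df f0 Fl; rewrite EFinB (@ge0_continuous_FTC2y _ f F 0 l)//.
- apply: derivable_continuous_within => x /=; rewrite in_itv/= andbT; exact: df.
- by move=> x x0; apply: ex_derive; apply: dF; exact: ltW.
- apply: cvg_at_right_filter; apply: differentiable_continuous.
  by apply/derivable1_diffP; apply: ex_derive; exact: dF.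
- move=> x; rewrite in_itv/= andbT derive1E => /ltW /dF.
  by move/@derive_val.
Qed.

Lemma is_derive_addl a u : is_derive u 1 (fun v => a + v) (1 : R).
Proof.
apply: (is_derive_eq (is_deriveD (is_derive_cst a u 1) (is_derive_id u 1))).
by rewrite add0r.
Qed.

Lemma cvg_inv_addr_pinfty a : 0 < a -> (a + u)^-1 @[u --> +oo] --> (0 : R).
Proof.
move=> a0; apply/cvgrPdist_le => e e0; near=> u.
have ue : e^-1 <= u by near: u; apply: nbhs_pinfty_ge; rewrite num_real.
have ei : 0 < e^-1 by rewrite invr_gt0.
have au : 0 < a + u by lra.
rewrite sub0r normrN gtr0_norm ?invr_gt0// -[leRHS]invrK lef_pV2 ?posrE//; lra.
Unshelve. all: by end_near. Qed.

Lemma integral_expR_linear (k g : R) : 0 < k -> 0 <= g ->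
  (\int[mu]_(u in `[0%R, +oo[) (g * expR (- (k * u)))%:E = (g / k)%:E)%E.
Proof.
move=> k0 g0; pose F u := - (g / k) * expR (- (k * u)).
rewrite (_ : g / k = 0 - F 0); last by rewrite /F mulr0 oppr0 expR0; ring.
apply: ge0_FTC2_0y.
- move=> u _; rewrite /F; apply: is_derive_eq.
  rewrite /GRing.scale/=. by field; rewrite gt_eqF.
- by move=> u _; apply: ex_derive.
- by move=> u _; rewrite mulr_ge0 ?expR_ge0.
- rewrite -(mulr0 (- (g / k))); apply: cvgMl_tmp.
  apply: (@cvg_comp _ _ _ (fun u => k * u) (fun v => expR (- v)) _ +oo) => //.
    by apply: gt0_cvgMry.
  exact: cvgr_expR.
Qed.

(** The integrand is the value that the double integral of [Qpow] takes at [z + u]. Its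
    antiderivative, the negative of [Re (c / (z + u)) + d / (Re z + u)], is written in real
    coordinates so that the real rules of derivation apply. *)
Lemma integral_inv_square c d z : 0 < complex.Re z -> normc c <= d ->
  (\int[mu]_(u in `[0%R, +oo[) (complex.Re (c / (z + Complex u 0) / (z + Complex u 0)) +
     d / (complex.Re z + u) / (complex.Re z + u))%:E =
   (complex.Re (c / z) + d / complex.Re z)%:E)%E.
Proof.
case: c z => [c1 c2] [a b] /= a0 cd.
have d0 : 0 <= d by rewrite (le_trans (sqrtr_ge0 _) cd).
pose N u := (a + u) ^+ 2 + b ^+ 2.
have N0 u : 0 <= u -> N u != 0.
  by move=> u0; rewrite gt_eqF// ltr_wpDr ?sqr_ge0// exprn_gt0//; lra.
have au0 u : 0 <= u -> a + u != 0 by move=> u0; rewrite gt_eqF//; lra.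
pose F u := - ((c1 * (a + u) + c2 * b) / N u + d / (a + u)).
pose f u := (c1 * ((a + u) ^+ 2 - b ^+ 2) + c2 * (2 * (a + u) * b)) / N u ^+ 2
  + d / (a + u) ^+ 2.
have fE u : 0 <= u ->
    complex.Re (Complex c1 c2 / (Complex a b + Complex u 0) / (Complex a b + Complex u 0)) +
    d / (a + u) / (a + u) = f u.
  move=> u0; rewrite /f /= addr0 -/(N u); congr (_ + _).
    by field; exact: N0.
  by field; exact: au0.
rewrite [RHS](_ : _ = (0 - F 0)%:E); last first.
  congr EFin; rewrite /F /N !addr0 sub0r opprK; congr (_ + _); ring.
have -> : (\int[mu]_(u in `[0%R, +oo[)
   (complex.Re (Complex c1 c2 / (Complex a b + Complex u 0) / (Complex a b + Complex u 0)) +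
     d / (a + u) / (a + u))%:E = \int[mu]_(u in `[0%R, +oo[) (f u)%:E)%E.
  by apply: eq_integral => u; rewrite inE/= in_itv/= andbT => /fE <-.
have dN u : is_derive u 1 N (2 * (a + u)).
  by rewrite /N; apply: is_derive_eq; rewrite /GRing.scale/=; ring.
have da := is_derive_addl a.
apply: ge0_FTC2_0y.
- move=> u u0; have n0 := N0 u u0; have a1 := au0 u u0.
  have h1 := is_deriveV n0 (dN u); have h2 := is_deriveV a1 (da u).
  rewrite /F; apply: is_derive_eq; rewrite /GRing.scale/= /f.
  by rewrite /N in n0 *; field; rewrite n0 a1.
- move=> u u0; have n0 := N0 u u0; have a1 := au0 u u0.
  have h1 := is_deriveV n0 (dN u); have h2 := is_deriveV a1 (da u).
  rewrite /f; under eq_fun do rewrite -!exprVn.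
  exact: ex_derive.
(* The modulus of [w = z + u] is at least its real part, so the term with [d] dominates the complex
   one. *)
- move=> u u0; rewrite -fE//.
  set w := Complex a b + Complex u 0.
  have wn : a + u <= normc w.
    by rewrite (le_trans _ (Re_le_normc _))//= ler_norm.
  have au : 0 < a + u by lra.
  have h := Re_le_normc (Complex c1 c2 / w / w).
  rewrite !normcM !normcV in h.
  have wi : (normc w)^-1 <= (a + u)^-1 by rewrite lef_pV2 ?posrE// (lt_le_trans au).
  have : normc (Complex c1 c2) / normc w / normc w <= d / (a + u) / (a + u).
    by rewrite !ler_pM ?mulr_ge0 ?invr_ge0 ?normc_ge0.
  move: h; rewrite ler_norml => /andP[]; lra.
- rewrite -oppr0; apply: cvgN; rewrite -[X in _ --> X](addr0 0).
  have ha := cvg_inv_addr_pinfty a a0.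
  apply: cvgD; last by rewrite -(mulr0 d); exact: cvgMl_tmp.
  apply: norm_cvg0.
  apply: (@squeeze_cvgr _ _ _ _ (cst 0) (fun u => normc (Complex c1 c2) * (a + u)^-1)).
  + near=> u; rewrite normr_ge0/=.
    have u0 : 0 <= u by near: u; apply: nbhs_pinfty_ge; rewrite num_real.
    have n0 := N0 u u0; have au : 0 < a + u by lra.
    have -> : (c1 * (a + u) + c2 * b) / N u =
        complex.Re (Complex c1 c2 / Complex (a + u) b).
      by rewrite /= -/(N u); field.
    rewrite (le_trans (Re_le_normc _))// normcM normcV ler_wpM2l ?normc_ge0//.
    have wn : a + u <= normc (Complex (a + u) b).
      by rewrite (le_trans _ (Re_le_normc _))//= ler_norm.
    by rewrite lef_pV2 ?posrE// (lt_le_trans au).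
  + exact: cvg_cst.
  + by rewrite -[X in _ --> X](mulr0 (normc (Complex c1 c2))); exact: cvgMl_tmp.
Unshelve. all: by end_near. Qed.

(** Partial fractions give the antiderivative [ln (a + u) - ln (a + 1 + u)], which tends to 0 at
    infinity since the quotient of the arguments tends to 1. *)
Lemma integral_inv_consecutive a : 0 < a ->
  (\int[mu]_(u in `[0%R, +oo[) ((a + u)^-1 / (a + 1 + u))%:E = (ln ((a + 1) / a))%:E)%E.
Proof.
move=> a0; pose F u := ln (a + u) - ln (a + 1 + u).
rewrite (_ : ln _ = 0 - F 0); last first.
  by rewrite /F !addr0 ln_div ?posrE ?addr_gt0//; ring.
apply: ge0_FTC2_0y.
- move=> u u0; have a1 : 0 < a + u by lra.
  have a2 : 0 < a + 1 + u by lra.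
  have da := is_derive_addl.
  have h1 := is_derive1_comp (is_derive1_ln a1) (da a u).
  have h2 := is_derive1_comp (is_derive1_ln a2) (da (a + 1) u).
  apply: (is_derive_eq (is_deriveB h1 h2)).
  by rewrite !mulr1; field; rewrite !gt_eqF.
- move=> u u0; have a1 : a + u != 0 by rewrite gt_eqF//; lra.
  have a2 : a + 1 + u != 0 by rewrite gt_eqF//; lra.
  have da := is_derive_addl.
  have h1 := is_deriveV a1 (da a u); have h2 := is_deriveV a2 (da (a + 1) u).
  exact: ex_derive.
- by move=> u u0; rewrite mulr_ge0 ?invr_ge0//; lra.
- have h : 1 + (a + u)^-1 @[u --> +oo] --> (1 : R).
    rewrite -[X in _ --> X](addr0 1); apply: cvgD; first exact: cvg_cst.
    exact: cvg_inv_addr_pinfty.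
  have hl : - ln (1 + (a + u)^-1) @[u --> +oo] --> (0 : R).
    by rewrite -oppr0 -ln1; apply: cvgN; apply: (cvg_comp _ _ h); exact: continuous_ln.
  apply: cvg_trans hl; apply: near_eq_cvg; near=> u.
  have u0 : 0 <= u by near: u; apply: nbhs_pinfty_ge; rewrite num_real.
  have a1 : 0 < a + u by lra.
  have a2 : 0 < a + 1 + u by lra.
  have -> : 1 + (a + u)^-1 = (a + 1 + u) / (a + u) by field; rewrite gt_eqF.
  by rewrite ln_div ?posrE// opprB.
Unshelve. all: by end_near. Qed.

End LaplaceTransform.

(** * Double integrals over the open unit square *)

Section UnitSquare.
Context {R : realType}.
Local Notation mu := (@lebesgue_measure R).
Local Notation U := (`]0%R, 1%R[%classic : set R).
Implicit Types (x y a d u : R) (c z w : R[i]) (p : R * R).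

(** Removing the negligible boundary ensures [0 < x y < 1], so that neither [1 - x y] nor [ln (x y)]
    vanishes. *)
Definition open_square : set (R * R) := U `*` U.

Lemma measurable_open_square : measurable open_square.
Proof. by apply: measurableX; exact: measurable_itv. Qed.

Lemma open_square_mul p : open_square p ->
  [/\ 0 < p.1, 0 < p.2, p.2 < 1, 0 < p.1 * p.2 & p.1 * p.2 < 1].
Proof.
case: p => x y [/=]; rewrite !in_itv/= => /andP[x0 x1] /andP[y0 y1].
by split => //; rewrite ?mulr_gt0// -[ltRHS]mulr1 ltr_pM// ltW.
Qed.

Lemma measurable_Re_cpow c w : measurable_fun setT (fun x : R => complex.Re (c * cpow x w)).
Proof.
case: c w => [c1 c2] [a b] /=.
have mx k : measurable_fun [set: R] (fun x : R => k * ln x).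
  by apply: measurable_funM => //; exact: measurable_ln.
have me : measurable_fun [set: R] (fun x : R => expR (a * ln x)).
  by apply: measurableT_comp.
apply: measurable_funB; apply: measurable_funM => //; apply: measurable_funM => //.
- by apply: measurableT_comp (mx b); apply: continuous_measurable_fun; exact: continuous_cos.
- by apply: measurableT_comp (mx b); apply: continuous_measurable_fun; exact: continuous_sin.
Qed.

Lemma measurable_Qpow c d z : measurable_fun setT (Qpow c d z).
Proof.
rewrite (_ : Qpow c d z = (fun x => complex.Re (c * cpow x (z - 1))) \+
  (fun x => complex.Re (Complex d 0 * cpow x (Complex (complex.Re z) 0 - 1)))).
  by apply: measurable_funD; exact: measurable_Re_cpow.
by apply/funext => x; rewrite QpowE.
Qed.

Lemma measurable_mul_pair : measurable_fun setT (fun p : R * R => p.1 * p.2).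
Proof. by apply: measurable_funM; [exact: measurable_fst|exact: measurable_snd]. Qed.

Lemma measurable_Qpow_mul c d z : measurable_fun setT (fun p : R * R => Qpow c d z (p.1 * p.2)).
Proof. exact: (measurableT_comp (measurable_Qpow c d z) measurable_mul_pair). Qed.

(** For fixed [y] the function of [x] stays in the [Qpow] family, its constants still satisfying the
    domination if [c] and [d] do; the one-variable integral can thus be used twice. *)
Lemma Qpow_mul c d z x y : 0 < x -> 0 < y ->
  Qpow c d z (x * y) =
  Qpow (c * cpow y (z - 1)) (d * expR ((complex.Re z - 1) * ln y)) z x.
Proof.
move=> x0 y0; rewrite /Qpow cpowM// lnM ?posrE// mulrDr expRD.
congr (_ + _); last by ring.
by congr complex.Re; ring.
Qed.

Lemma Qpow_expR c d z u x : Qpow c d z x * expR (u * ln x) = Qpow c d (z + Complex u 0) x.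
Proof.
rewrite /Qpow (_ : z + Complex u 0 - 1 = z - 1 + Complex u 0); last by ring.
rewrite (cpowD x (z - 1) (Complex u 0)) cpow_real ReD [c * (_ * _)]mulrA.
rewrite (_ : complex.Re z + complex.Re (Complex u 0) - 1 = complex.Re z - 1 + u); last first.
  by rewrite /=; ring.
rewrite (mulrDl (complex.Re z - 1)) expRD mulrDl; congr (_ + _); last by rewrite mulrA.
by case: (c * cpow x (z - 1)) => r i /=; rewrite mulr0 subr0.
Qed.

(** The integral over [x] leaves [Qpow (c / z) (d / Re z) z y], so the integral over [y] divides by
    [z] and by [Re z] a second time. The domination persists because [Re z <= normc z]. *)
Lemma integral_Qpow_mul c d z : 0 < complex.Re z -> normc c <= d ->
  (\int[mu \x mu]_(p in open_square) (Qpow c d z (p.1 * p.2))%:E =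
   (complex.Re (c / z / z) + d / complex.Re z / complex.Re z)%:E)%E.
Proof.
move=> z0 cd.
have zn : complex.Re z <= normc z.
  by rewrite (le_trans _ (Re_le_normc _))// ler_norm.
rewrite (tonelli_rectangle2 mu mu U U); first last.
- by move=> p _; rewrite lee_fin Qpow_ge0.
- by apply/measurable_EFinP; exact: measurable_Qpow_mul.
- exact: measurable_itv.
- exact: measurable_itv.
rewrite -integral_Qpow//; last first.
  rewrite normcM normcV ler_pM ?normc_ge0 ?invr_ge0 ?normc_ge0//.
  by rewrite lef_pV2 ?posrE// (lt_le_trans z0).
apply: eq_integral => y; rewrite inE/= in_itv/= => /andP[y0 _].
transitivity (\int[mu]_(x in U) (Qpow (c * cpow y (z - 1))
    (d * expR ((complex.Re z - 1) * ln y)) z x)%:E)%E.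
  by apply: eq_integral => x; rewrite inE/= in_itv/= => /andP[x0 _]; rewrite Qpow_mul.
rewrite integral_Qpow//; last first.
  by rewrite normcM normc_cpow ReD ReN/= ler_wpM2r ?expR_ge0.
by rewrite /Qpow mulrAC [d * _ / _]mulrAC.
Qed.

(** The extra factor [y] raises its exponent by one: the integral over [x] leaves [y ^ a / a]. *)
Lemma integral_snd_Qpow_mul a : 0 < a ->
  (\int[mu \x mu]_(p in open_square) (p.2 * Qpow 0 1 (Complex a 0) (p.1 * p.2))%:E =
   (a^-1 / (a + 1))%:E)%E.
Proof.
move=> a0.
rewrite (tonelli_rectangle2 mu mu U U); first last.
- move=> p /open_square_mul[_ p2 _ _ _].
  by rewrite lee_fin mulr_ge0 ?Qpow_ge0 ?normc0// ltW.
- apply/measurable_EFinP; apply: measurable_funM; first exact: measurable_snd.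
  exact: measurable_Qpow_mul.
- exact: measurable_itv.
- exact: measurable_itv.
have a1 : 0 < a + 1 by lra.
transitivity (\int[mu]_(y in U) (Qpow 0 a^-1 (Complex (a + 1) 0) y)%:E)%E; last first.
  by rewrite integral_Qpow ?normc0 ?invr_ge0 ?ltW// mul0r add0r.
apply: eq_integral => y; rewrite inE/= in_itv/= => /andP[y0 _].
transitivity (\int[mu]_(x in U) (Qpow 0 (expR (a * ln y)) (Complex a 0) x)%:E)%E.
  apply: eq_integral => x; rewrite inE/= in_itv/= => /andP[x0 _].
  rewrite Qpow_mul// /Qpow !mul0r !add0r mul1r mulrA; congr (_ * _)%:E.
  by rewrite /= mulrBl mul1r expRB lnK// mulrC divfK// gt_eqF.
rewrite integral_Qpow// ?normc0 ?expR_ge0//.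
by rewrite /Qpow !mul0r !add0r /= addrK mulrC.
Qed.

(* [1 / (- ln t)] is the integral of [t ^ u] over [u >= 0]. *)
Lemma integral_div_ln (g : R * R -> R) : measurable_fun setT g ->
  (forall p, open_square p -> 0 <= g p) ->
  (\int[mu \x mu]_(p in open_square) (g p / - ln (p.1 * p.2))%:E =
   \int[mu]_(u in `[0%R, +oo[) \int[mu \x mu]_(p in open_square)
     (g p * expR (u * ln (p.1 * p.2)))%:E)%E.
Proof.
move=> mg g0.
pose f (q : (R * R) * R) : \bar R := (g q.1 * expR (q.2 * ln (q.1.1 * q.1.2)))%:E.
have mf : measurable_fun setT f.
  apply/measurable_EFinP; apply: measurable_funM.
    exact: (measurableT_comp mg measurable_fst).
  apply: measurableT_comp => //; apply: measurable_funM; first exact: measurable_snd.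
  apply: measurableT_comp; first exact: measurable_ln.
  exact: (measurableT_comp measurable_mul_pair measurable_fst).
have f0 q : (open_square `*` `[0%R, +oo[%classic) q -> (0 <= f q)%E.
  by move=> [/= /g0 gq _]; rewrite lee_fin mulr_ge0// expR_ge0.
have mI : measurable (`[0%R, +oo[%classic : set R) by exact: measurable_itv.
have h := tonelli_triple mu mu mu open_square `[0%R, +oo[%classic f
  measurable_open_square mI mf f0.
transitivity (\int[mu \x mu]_(p in open_square) \int[mu]_(u in `[0%R, +oo[) f (p, u))%E;
  last exact: h.
apply: eq_integral => p; rewrite inE => pU.
have [_ _ _ t0 t1] := open_square_mul _ pU.
have l0 : 0 < - ln (p.1 * p.2) by rewrite oppr_gt0 ln_lt0// t0 t1.
rewrite -integral_expR_linear ?g0//; apply: eq_integral => u _.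
by rewrite /f /= mulNr opprK mulrC [u * _]mulrC mulrC.
Qed.

(** Inserting [t ^ u] replaces [z] by [z + u], so the inner double integral is known and only the
    integral over [u] remains. *)
Lemma integral_Qpow_div_ln c d z : 0 < complex.Re z -> normc c <= d ->
  (\int[mu \x mu]_(p in open_square) (Qpow c d z (p.1 * p.2) / - ln (p.1 * p.2))%:E =
   (complex.Re (c / z) + d / complex.Re z)%:E)%E.
Proof.
move=> z0 cd.
rewrite (integral_div_ln (fun p => Qpow c d z (p.1 * p.2))); first last.
- by move=> p _; exact: Qpow_ge0.
- exact: measurable_Qpow_mul.
rewrite -integral_inv_square//; apply: eq_integral => u.
rewrite inE/= in_itv/= andbT => u0.
have E : complex.Re (z + Complex u 0) = complex.Re z + u by rewrite ReD.
rewrite -E -integral_Qpow_mul//; last by rewrite E ltr_wpDr.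
by apply: eq_integral => p _; rewrite Qpow_expR.
Qed.

Lemma integral_snd_Qpow_div_ln a : 0 < a ->
  (\int[mu \x mu]_(p in open_square)
     (p.2 * Qpow 0 1 (Complex a 0) (p.1 * p.2) / - ln (p.1 * p.2))%:E =
   (ln ((a + 1) / a))%:E)%E.
Proof.
move=> a0.
rewrite (integral_div_ln (fun p => p.2 * Qpow 0 1 (Complex a 0) (p.1 * p.2))); first last.
- move=> p /open_square_mul[_ p2 _ _ _].
  by rewrite mulr_ge0 ?Qpow_ge0 ?normc0// ltW.
- apply: measurable_funM; first exact: measurable_snd.
  exact: measurable_Qpow_mul.
rewrite -integral_inv_consecutive//; apply: eq_integral => u.
rewrite inE/= in_itv/= andbT => u0.
have au : 0 < a + u by lra.
rewrite (_ : a + 1 + u = a + u + 1); last by ring.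
rewrite -integral_snd_Qpow_mul//.
apply: eq_integral => p _; rewrite -mulrA Qpow_expR.
congr (_ * Qpow _ _ _ _)%:E.
by apply/eqP; rewrite eq_complex /= addr0 !eqxx.
Qed.

End UnitSquare.

(** * Telescoping against powers of a function with values in [[0, 1[], and integration tools *)

Section GeometricTelescope.
Context {d : measure_display} {T : measurableType d} {R : realType}.
Variables (m : {measure set T -> \bar R}) (D : set T) (f t : T -> R).
Hypotheses (mD : measurable D) (mf : m.-integrable D (EFin \o f)).
Hypotheses (mt : measurable_fun D t) (t01 : forall p, D p -> 0 <= t p < 1).

Let ft n p := f p * t p ^+ n.

Let mft n : measurable_fun D (ft n).
Proof.
apply: measurable_funM; last exact: measurable_funX.
by apply/measurable_EFinP; exact: measurable_int mf.
Qed.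

Let norm_ft n p : D p -> `|ft n p| <= `|f p|.
Proof.
move=> /t01/andP[t0 t1]; rewrite normrM ler_piMr// ger0_norm ?exprn_ge0//.
by rewrite exprn_ile1// ltW.
Qed.

Let ift n : m.-integrable D (EFin \o ft n).
Proof.
apply: le_integrable mf => //; first exact/measurable_EFinP.
by move=> p Dp; rewrite /= lee_fin norm_ft.
Qed.

Let cvg_ft : (\int[m]_(p in D) ft n p)%R @[n --> \oo] --> (0 : R).
Proof.
have h : (\int[m]_(p in D) (ft n p)%:E)%E @[n --> \oo] --> (\int[m]_(p in D) (0%:E))%E.
  apply: (@dominated_cvg _ _ _ m D mD (fun n p => (ft n p)%:E) (cst 0%E)
    (fun p => `|f p|%:E)).
  - by move=> n; exact/measurable_EFinP.
  - move=> p Dp; apply: cvg_EFin; first exact: nearW.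
    rewrite -(mulr0 (f p)); apply: cvgMl_tmp; apply: cvg_expr.
    by have /andP[t0 t1] := t01 _ Dp; rewrite ger0_norm.
  - by [].
  - exact: integrable_norm.
  - by move=> n p Dp /=; rewrite lee_fin norm_ft.
rewrite integral0 in h.
exact: (@fine_cvg _ _ _ _ (fun n => \int[m]_(p in D) (ft n p)%:E)%E 0 h).
Qed.

(** [f * t ^ n * (1 - t)] is a difference of consecutive [ft], so the partial sums equal the
    integral of [f] minus that of [ft n]; the latter tends to 0 by dominated convergence under
    [|f|]. *)
Lemma cvg_sum_Rintegral_geometric (v : nat -> R) :
  (forall n, \int[m]_(p in D) (f p * t p ^+ n * (1 - t p)) = v n)%R ->
  (\sum_(k < n) v k) @[n --> \oo] --> (\int[m]_(p in D) f p)%R.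
Proof.
move=> Hv.
have E n : \sum_(k < n) v k =
    (\int[m]_(p in D) f p - \int[m]_(p in D) ft n p)%R.
  elim: n => [|n IH].
    rewrite big_ord0 [X in _ = _ - X](_ : _ = \int[m]_(p in D) f p)%R ?subrr//.
    by apply: eq_Rintegral => p _; rewrite /ft expr0 mulr1.
  rewrite big_ord_recr/= IH -Hv.
  rewrite (_ : (\int[m]_(p in D) (f p * t p ^+ n * (1 - t p)) =
      \int[m]_(p in D) (ft n p - ft n.+1 p))%R); last first.
    by apply: eq_Rintegral => p _; rewrite /ft exprSr; ring.
  by rewrite RintegralB//; ring.
rewrite (funext E).
rewrite -[X in _ --> X]subr0; apply: cvgB; first exact: cvg_cst.
exact: cvg_ft.
Qed.

End GeometricTelescope.

Lemma ge0_integrable_EFin {d : measure_display} {T : measurableType d} {R : realType}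
    (m : {measure set T -> \bar R}) (D : set T) (f : T -> R) (r : R) :
  measurable D -> measurable_fun D f -> (forall p, D p -> 0 <= f p) ->
  (\int[m]_(p in D) (f p)%:E = r%:E)%E ->
  m.-integrable D (EFin \o f) /\ (\int[m]_(p in D) f p = r)%R.
Proof.
move=> mD mf f0 fr; split; last by rewrite /Rintegral fr.
apply/integrableP; split; first exact/measurable_EFinP.
rewrite (_ : (\int[m]_(p in D) _)%E = r%:E) ?ltry// -fr.
by apply: eq_integral => p; rewrite inE => Dp /=; rewrite ger0_norm ?f0.
Qed.

Lemma Rintegral_lincomb {d : measure_display} {T : measurableType d} {R : realType}
    (m : {measure set T -> \bar R}) (D : set T) (f1 f2 f3 : T -> R) (r : R) :
  measurable D -> m.-integrable D (EFin \o f1) -> m.-integrable D (EFin \o f2) ->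
  m.-integrable D (EFin \o f3) ->
  (\int[m]_(p in D) (f2 p - f1 p + r * f3 p) =
   \int[m]_(p in D) f2 p - \int[m]_(p in D) f1 p + r * \int[m]_(p in D) f3 p)%R.
Proof.
move=> mD i1 i2 i3.
have i12 : m.-integrable D (EFin \o (fun p => f2 p - f1 p)).
  by have := integrableB mD i2 i1; apply: eq_integrable.
have i3r : m.-integrable D (EFin \o (fun p => r * f3 p)).
  by have := integrableZl mD r i3; apply: eq_integrable.
by rewrite (RintegralD mD i12 i3r) RintegralB// RintegralZl.
Qed.

(** The integrals [1 / e] would all be bounded by the integral [M] of [|f1| + |f2|]; the choice
    [e = 1 / (|M| + 1)] contradicts this. *)
Lemma integral_norms_unbounded {d : measure_display} {T : measurableType d} {R : realType}
    (m : {measure set T -> \bar R}) (D : set T) (f1 f2 : T -> R) (g : R -> T -> R) :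
  measurable D -> m.-integrable D (EFin \o f1) -> m.-integrable D (EFin \o f2) ->
  (forall e, 0 < e <= 1 -> m.-integrable D (EFin \o g e) /\ (\int[m]_(p in D) g e p = e^-1)%R) ->
  (forall e p, 0 < e <= 1 -> D p -> g e p <= `|f1 p| + `|f2 p|) -> False.
Proof.
move=> mD i1 i2 ig gf.
have i12 : m.-integrable D (EFin \o (fun p => `|f1 p| + `|f2 p|)).
  have := integrableD mD (integrable_norm i1) (integrable_norm i2).
  exact: eq_integrable.
pose M := (\int[m]_(p in D) (`|f1 p| + `|f2 p|))%R.
have e01 : 0 < (`|M| + 1)^-1 <= 1.
  by rewrite invr_gt0 ltr_wpDl//= invf_le1 ?ltr_wpDl// lerDr.
have [ie Ee] := ig _ e01.
have := le_Rintegral mD ie i12 (fun p => gf _ p e01).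
rewrite Ee invrK -/M; have := ler_norm M; lra.
Qed.

Lemma Rintegral_subset_negligible {d : measure_display} {T : measurableType d} {R : realType}
    (m : {measure set T -> \bar R}) (A B : set T) (f : T -> R) :
  measurable A -> measurable B -> B `<=` A -> m (A `\` B) = 0%E ->
  m.-integrable A (EFin \o f) ->
  (\int[m]_(p in A) f p = \int[m]_(p in B) f p)%R.
Proof.
move=> mA mB BA AB0 fi; rewrite /Rintegral.
have mAB : measurable (A `\` B) by exact: measurableD.
by rewrite (negligible_integral mAB mA fi AB0) setDD (setIidr BA).
Qed.

(** * The integrand itself: reduction to [Qpow], term-by-term evaluation, positivity of [Re s] *)

Section MainIntegral.
Context {R : realType}.
Local Notation mu := (@lebesgue_measure R).
Local Notation D := (@open_square R).
Implicit Types (c s z : R[i]) (p : R * R).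

Lemma open_square_sub : D `<=` @unit_square R.
Proof. by move=> -[x y] [/= /subset_itv_oo_cc ? /subset_itv_oo_cc]. Qed.

Lemma measurable_unit_square : measurable (@unit_square R).
Proof. by apply: measurableX; exact: measurable_itv. Qed.

Lemma unit_square_diff0 : (mu \x mu)%E (@unit_square R `\` D) = 0%E.
Proof.
have mQ : (mu \x mu)%E (@unit_square R) = 1%E.
  transitivity (mu `[0%R, 1%R] * mu `[0%R, 1%R])%E; first exact: product_measure1E.
  by rewrite lebesgue_measure_itv/= lte_fin ltr01 sube0 mule1.
have mU : (mu \x mu)%E D = 1%E.
  transitivity (mu `]0%R, 1%R[ * mu `]0%R, 1%R[)%E; first exact: product_measure1E.
  by rewrite lebesgue_measure_itv/= lte_fin ltr01 sube0 mule1.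
rewrite measureD; last 3 first.
- exact: measurable_unit_square.
- exact: measurable_open_square.
- by rewrite [X in (X < _)%E]mQ ltry.
rewrite (setIidr open_square_sub).
by rewrite [X in (X - _)%E]mQ [X in (_ - X)%E]mU subee.
Qed.

Lemma integrable_open_square (f : R * R -> \bar R) :
  (mu \x mu)%E.-integrable (@unit_square R) f -> (mu \x mu)%E.-integrable D f.
Proof.
apply: integrableS; [exact: measurable_unit_square|exact: measurable_open_square|].
exact: open_square_sub.
Qed.

Lemma Rintegral_open_square (f : R * R -> R) :
  (mu \x mu)%E.-integrable (@unit_square R) (EFin \o f) ->
  (\int[(mu \x mu)%E]_(p in @unit_square R) f p = \int[(mu \x mu)%E]_(p in D) f p)%R.
Proof.
apply: Rintegral_subset_negligible.
- exact: measurable_unit_square.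
- exact: measurable_open_square.
- exact: open_square_sub.
- exact: unit_square_diff0.
Qed.

Lemma ln_mul_lt0 p : D p -> 0 < - ln (p.1 * p.2).
Proof.
by move=> /open_square_mul[_ _ _ t0 t1]; rewrite oppr_gt0 ln_lt0// t0 t1.
Qed.

(** On the open square [- ln (p.1 * p.2)] is positive, so its inverse is the power with exponent
    [- 1], and measurability of [powR] applies. *)
Lemma measurable_div_ln (g : R * R -> R) : measurable_fun setT g ->
  measurable_fun D (fun p => g p / - ln (p.1 * p.2)).
Proof.
move=> mg; apply: measurable_funM; first exact: measurable_funTS.
apply: (@eq_measurable_fun _ _ _ _ D (fun p => (- ln (p.1 * p.2)) `^ (- 1))).
  by move=> p; rewrite inE => /ln_mul_lt0 l0; rewrite powR_inv1// ltW.
apply: measurable_funTS; apply: (measurableT_comp (measurable_powR _)).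
apply: measurableT_comp => //.
exact: (measurableT_comp (@measurable_ln R) measurable_mul_pair).
Qed.

Lemma Rintegral_Qpow_div_ln c d z : 0 < complex.Re z -> normc c <= d ->
  (mu \x mu)%E.-integrable D (EFin \o (fun p => Qpow c d z (p.1 * p.2) / - ln (p.1 * p.2))) /\
  (\int[(mu \x mu)%E]_(p in D) (Qpow c d z (p.1 * p.2) / - ln (p.1 * p.2)) =
    complex.Re (c / z) + d / complex.Re z)%R.
Proof.
move=> z0 cd; apply: ge0_integrable_EFin.
- exact: measurable_open_square.
- exact: (measurable_div_ln _ (measurable_Qpow_mul c d z)).
- by move=> p /ln_mul_lt0 l0; rewrite mulr_ge0 ?Qpow_ge0// invr_ge0 ltW.
- exact: integral_Qpow_div_ln.
Qed.

Lemma Rintegral_snd_Qpow_div_ln a : 0 < a ->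
  (mu \x mu)%E.-integrable D (EFin \o (fun p =>
     p.2 * Qpow 0 1 (Complex a 0) (p.1 * p.2) / - ln (p.1 * p.2))) /\
  (\int[(mu \x mu)%E]_(p in D) (p.2 * Qpow 0 1 (Complex a 0) (p.1 * p.2) / - ln (p.1 * p.2)) =
    ln ((a + 1) / a))%R.
Proof.
move=> a0; apply: ge0_integrable_EFin.
- exact: measurable_open_square.
- apply: (measurable_div_ln (fun p => p.2 * Qpow 0 1 (Complex a 0) (p.1 * p.2))).
  by apply: measurable_funM; [exact: measurable_snd|exact: measurable_Qpow_mul].
- move=> p pU; have l0 := ln_mul_lt0 _ pU; have [_ p2 _ _ _] := open_square_mul _ pU.
  by rewrite mulr_ge0 ?invr_ge0 ?mulr_ge0 ?Qpow_ge0 ?normc0// ltW.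
- exact: integral_snd_Qpow_div_ln.
Qed.

Lemma Re_divr z (r : R) : complex.Re (z / Complex r 0) = complex.Re z / r.
Proof.
have -> : (Complex r 0)^-1 = Complex r^-1 0 by exact/esym/(fmorphV (real_complex R)).
by case: z => a b /=; rewrite mulr0 subr0.
Qed.

(** The factor [1 - t] cancels in the denominator and leaves [Re (c * (t ^ (s + n - 1) - y * t ^ n))
    / ln t]. The modulus term is added and subtracted so that, when [normc c <= d], each piece is a
    multiple of a nonnegative function with known integral. *)
Lemma Re_integrand_geometric c s d n p : D p ->
  complex.Re (c * integrand s p) * (p.1 * p.2) ^+ n * (1 - p.1 * p.2) =
  Qpow 0 d (s + n%:R) (p.1 * p.2) / - ln (p.1 * p.2)
  - Qpow c d (s + n%:R) (p.1 * p.2) / - ln (p.1 * p.2)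
  + complex.Re c * (p.2 * Qpow 0 1 (Complex n.+1%:R 0) (p.1 * p.2) / - ln (p.1 * p.2)).
Proof.
move=> pU; have [_ _ _ t0 t1] := open_square_mul _ pU; have := ln_mul_lt0 _ pU.
rewrite /integrand /=; move: p.2 (p.1 * p.2) t0 t1 => y t t0 t1 l0.
have En : t ^+ n = expR (n%:R * ln t).
  by rewrite (mulrC n%:R) expRM_natr lnK ?posrE.
have nE : n%:R = Complex n%:R 0 :> R[i] by rewrite -[LHS](rmorph_nat (real_complex R)).
rewrite [c * _]mulrA Re_divr (mulrBr c) ReD ReN.
have -> : complex.Re (c * Complex y 0) = complex.Re c * y.
  by case: c => c1 c2 /=; rewrite mulr0 subr0.
rewrite nE -!Qpow_expR -En /Qpow mul0r /= add0r mul1r -natr1 addrK -En add0r.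
have h1 : 1 - t != 0 by rewrite subr_eq0 gt_eqF.
have h2 : ln t != 0 by rewrite -oppr_eq0 gt_eqF.
by field; rewrite h1 h2.
Qed.

Lemma cvg_sum_digamma_term c s : 0 < complex.Re s ->
  (mu \x mu)%E.-integrable D (EFin \o (fun p => complex.Re (c * integrand s p))) ->
  (\sum_(k < n) complex.Re (c * digamma_term s k)) @[n --> \oo] -->
  (\int[(mu \x mu)%E]_(p in D) complex.Re (c * integrand s p))%R.
Proof.
move=> s0 ci.
have t01 p : D p -> 0 <= p.1 * p.2 < 1.
  by move=> /open_square_mul[_ _ _ t0 ->]; rewrite ltW.
have mt : measurable_fun D (fun p : R * R => p.1 * p.2).
  by apply: measurable_funTS; exact: measurable_mul_pair.
apply: (@cvg_sum_Rintegral_geometric _ _ R [the measure _ _ of (mu \x mu)%E] D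
  (fun p => complex.Re (c * integrand s p)) (fun p => p.1 * p.2) measurable_open_square
  ci mt t01 (fun k => complex.Re (c * digamma_term s k))).
move=> n; have sn : 0 < complex.Re (s + n%:R) by exact: Re_addnat_gt0.
have [i1 I1] := Rintegral_Qpow_div_ln c _ _ sn (lexx (normc c)).
have c0 : normc (0 : R[i]) <= normc c by rewrite normc0 normc_ge0.
have [i2 I2] := Rintegral_Qpow_div_ln 0 _ _ sn c0.
have [i3 I3] := Rintegral_snd_Qpow_div_ln n.+1%:R (ltr0Sn R n).
have h := @Rintegral_lincomb _ _ R [the measure _ _ of (mu \x mu)%E] D _ _ _ (complex.Re c)
  measurable_open_square i1 i2 i3.
apply: (etrans (etrans _ h)).
  apply: eq_Rintegral => p; rewrite inE => pD.
  exact: Re_integrand_geometric.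
(* The contributions [normc c / Re (s + n)] of [I2] and [I1] cancel, which leaves
   [Re (c * digamma_term s n)]. *)
rewrite [X in X - _ + _]I2 [X in _ - X + _]I1 [X in _ + _ * X]I3.
rewrite natr1 /digamma_term (mulrBr c) [complex.Re (_ - _)]ReD ReN mul0r.
have -> : complex.Re (c * Complex (ln (n.+2%:R / n.+1%:R)) 0) =
    complex.Re c * ln (n.+2%:R / n.+1%:R).
  by case: (c) => c1 c2 /=; rewrite mulr0 subr0.
by rewrite /=; ring.
Qed.

(** Giving [g] through an equation lets one statement serve for [complex.Re] and [complex.Im] as
    they appear in the integrals. *)
Lemma cvg_sum_digamma_term_square c s (g : R[i] -> R) :
  g = (fun w => complex.Re (c * w)) -> 0 < complex.Re s ->
  (@leb2 R).-integrable (@unit_square R) (fun p => (g (integrand s p))%:E) ->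
  (\sum_(k < n) g (digamma_term s k)) @[n --> \oo] -->
  Rintegral (@leb2 R) (@unit_square R) (fun p => g (integrand s p)).
Proof.
move=> -> s0 gi; rewrite /leb2 (Rintegral_open_square _ gi).
exact: cvg_sum_digamma_term s0 (integrable_open_square _ gi).
Qed.

Lemma Re_gt0_of_integrable s :
  (mu \x mu)%E.-integrable D (EFin \o (fun p => complex.Re (integrand s p))) ->
  (mu \x mu)%E.-integrable D (EFin \o (fun p => complex.Im (integrand s p))) ->
  0 < complex.Re s.
Proof.
move=> ir ii; rewrite ltNge; apply/negP => s0.
apply: (@integral_norms_unbounded _ _ R [the measure _ _ of (mu \x mu)%E] D _ _
  (fun e p => Qpow 0 1 (Complex e 0) (p.1 * p.2) / - ln (p.1 * p.2))
  measurable_open_square ir ii).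
  move=> e /andP[e0 _].
  have [i1 I1] := Rintegral_Qpow_div_ln 0 1 (Complex e 0) e0 (ltac:(by rewrite normc0)).
  by split=> //; rewrite I1 mul0r /= add0r mul1r.
move=> e p /andP[e0 _] pU; rewrite (le_trans _ (normc_le_ReIm _))//.
have [_ y0 y1 t0 t1] := open_square_mul _ pU; have := ln_mul_lt0 _ pU.
have -> : integrand s p = (cpow (p.1 * p.2) (s - 1) - Complex p.2 0) /
  Complex ((1 - p.1 * p.2) * ln (p.1 * p.2)) 0 by [].
move: p.2 y0 y1 (p.1 * p.2) t0 t1 => y y0 y1 t t0 t1 l0.
rewrite normcM normcV normc_real normrM (gtr0_norm (_ : 0 < 1 - t)) ?subr_gt0//.
rewrite -[`|ln t|]normrN (gtr0_norm l0).
have t1' : 0 < 1 - t by lra.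
have ti : 0 < t^-1 by rewrite invr_gt0.
(* The left side is [t ^ (e - 1)], with [t < 1] and [e > 0]. *)
have q : Qpow 0 1 (Complex e 0) t <= t^-1.
  rewrite /Qpow mul0r /= add0r mul1r -[leRHS]lnK ?posrE// ler_expR lnV ?posrE//.
  by nra.
(* As [Re s <= 0], the power has modulus at least [1 / t], while [y < 1]. The bound equals
   [(1 - t) / t], whose factor [1 - t] cancels against the denominator of the integrand. *)
have h : t^-1 - 1 <= normc (cpow t (s - 1) - Complex y 0).
  have : normc (cpow t (s - 1)) <= normc (cpow t (s - 1) - Complex y 0) + normc (Complex y 0).
    by rewrite -{1}(subrK (Complex y 0) (cpow t (s - 1))) le_normcD.
  rewrite normc_real (gtr0_norm y0) normc_cpow ReD ReN /=.
  have : t^-1 <= expR ((complex.Re s - 1) * ln t).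
    rewrite -[leLHS]lnK ?posrE// ler_expR lnV ?posrE//; nra.
  lra.
rewrite invfM mulrA ler_wpM2r ?invr_ge0 ?(ltW l0)//.
rewrite ler_pdivlMr// (le_trans _ h)//.
have -> : t^-1 - 1 = t^-1 * (1 - t) by field; rewrite gt_eqF.
by rewrite ler_wpM2r// ltW.
Qed.

End MainIntegral.

(* The complex-valued integral converges (is Lebesgue integrable on [0,1]^2,
   i.e. both its real and imaginary parts are), and then equals digamma s. *)
Theorem theorem3p7 (R : realType) (s : R[i]) :
  (@leb2 R).-integrable (@unit_square R)
     (fun p => (complex.Re (integrand s p))%:E) ->
  (@leb2 R).-integrable (@unit_square R)
     (fun p => (complex.Im (integrand s p))%:E) ->
  digamma s =
    Complex (Rintegral (@leb2 R) (@unit_square R) (fun p => complex.Re (integrand s p)))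
            (Rintegral (@leb2 R) (@unit_square R) (fun p => complex.Im (integrand s p))).
Proof.
move=> ir ii.
have s0 := Re_gt0_of_integrable s (integrable_open_square _ ir) (integrable_open_square _ ii).
have ReE : @complex.Re R = (fun w => complex.Re (1 * w)).
  by apply/funext => w; rewrite mul1r.
(* Multiplication by [- i] turns the imaginary part into a real part, so the real statement covers
   both coordinates. *)
have ImE : @complex.Im R = (fun w => complex.Re (Complex 0 (- 1) * w)).
  by apply/funext => -[a b] /=; rewrite mul0r sub0r mulN1r opprK.
apply: digamma_lim => //; apply: cvgc_ReIm.
  rewrite (_ : (fun n => complex.Re _) = (fun n => \sum_(k < n) complex.Re (digamma_term s k)));
    last by apply/funext => n; exact: (big_morph _ (@ReD R)).
  exact: cvg_sum_digamma_term_square ReE s0 ir.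
rewrite (_ : (fun n => complex.Im _) = (fun n => \sum_(k < n) complex.Im (digamma_term s k)));
    last by apply/funext => n; exact: (big_morph _ (@ImD R)).
exact: cvg_sum_digamma_term_square ImE s0 ii.
Qed.
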